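(* Let $F$ be a differentially closed field of characteristic zero with derivations $d_x,d_y$, and let $P\in F[d_x,d_y]$ be a linear partial differential operator of order $n=\mathrm{ord}(P)$ whose symbol $\mathrm{symb}(P)\in F[v,w]$ is separable. Then there exist at most $n$ maximal non-holonomic overideals of the left ideal $\langle P\rangle\subset F[d_x,d_y]$. Moreover, if there exists a non-holonomic overideal $I\supset\langle P\rangle$ with attached polynomial $g=\mathrm{GCD}(\mathrm{symb}(I))$, then there exists a unique non-holonomic overideal of $\langle P\rangle$ that is maximal among the non-holonomic overideals of $\langle P\rangle$ with attached polynomial equal to $g$.
   Context: The derivations $d_x,d_y$ of $F$ commute, and $F[d_x,d_y]$ is the (non-commutative) ring of linear partial differential operators $\sum_{i,j}p_{i,j}d_x^id_y^j$ with coefficients $p_{i,j}\in F$, where $d_xd_y=d_yd_x$, $d_x f=f d_x+d_x(f)$ and $d_y f=f d_y+d_y(f)$ for $f\in F$. All ideals are left ideals, and $\langle P\rangle$ denotes the left ideal generated by $P$. For an operator $P=\sum_{i+j\le n}p_{i,j}d_x^id_y^j$ of order $n$, its symbol is the homogeneous polynomial $\mathrm{symb}(P)=\sum_{i+j=n}p_{i,j}v^iw^j\in F[v,w]$ of degree $n$. It is separable if it has no multiple linear factors. For a left ideal $I$, the Hilbert-Kolchin polynomial is the polynomial in $z$ which for all large integers $z$ equals the $F$-dimension of the image in $F[d_x,d_y]/I$ of the space of operators of order at most $z$. The ideal $I$ is called non-holonomic if its Hilbert-Kolchin polynomial has degree exactly $1$, i.e. is of the form $ez+e_0$ with $e\ge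 1$. For a left ideal $I$, $\mathrm{symb}(I)\subset F[v,w]$ is the homogeneous ideal generated by the symbols of the elements of $I$, and the polynomial attached to $I$ is $\mathrm{GCD}(\mathrm{symb}(I))$, the (homogeneous) greatest common divisor of the elements of $\mathrm{symb}(I)$, defined up to a nonzero factor in $F$ (equality of attached polynomials is understood up to such a factor). An overideal of an ideal $J$ is a left ideal containing $J$ (possibly equal to $J$). A maximal non-holonomic overideal of $J$ is a non-holonomic overideal of $J$ which is maximal with respect to inclusion among all non-holonomic overideals of $J$. *)

(* Defs.v *)
From HB Require Import structures.
From mathcomp Require Import all_boot all_order all_algebra.
From mathcomp.multinomials Require Export mpoly.

Set Implicit Arguments.
Unset Strict Implicit.
Unset Printing Implicit Defensive.

Import GRing.Theory.
Local Open Scope ring_scope.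

HB.mixin Record Field_hasTwoDerivations F of GRing.Field F := {
  dx : F -> F;
  dy : F -> F;
  dxD : forall f g, dx (f + g) = dx f + dx g;
  dyD : forall f g, dy (f + g) = dy f + dy g;
  dxM : forall f g, dx (f * g) = dx f * g + f * dx g;
  dyM : forall f g, dy (f * g) = dy f * g + f * dy g;
  dxdyC : forall f, dx (dy f) = dy (dx f)
}.

#[short(type="diffFieldType")]
HB.structure Definition DiffField :=
  { F of GRing.Field F & Field_hasTwoDerivations F }.

Lemma dx_is_additive (F : diffFieldType) : zmod_morphism (@dx F).
Proof.
have dx0 : dx (0 : F) = 0.
  by apply: (addrI (dx (0 : F))); rewrite -dxD !addr0.
move=> f g; apply/eqP; rewrite eq_sym subr_eq -dxD subrK; exact/eqP.
Qed.

Lemma dy_is_additive (F : diffFieldType) : zmod_morphism (@dy F).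
Proof.
move=> f g; apply/eqP; rewrite eq_sym subr_eq -dyD subrK; exact/eqP.
Qed.

HB.instance Definition _ (F : diffFieldType) :=
  GRing.isZmodMorphism.Build F F (@dx F) (@dx_is_additive F).
HB.instance Definition _ (F : diffFieldType) :=
  GRing.isZmodMorphism.Build F F (@dy F) (@dy_is_additive F).

Lemma dx1 (F : diffFieldType) : dx (1 : F) = 0.
Proof. by apply: (addrI (dx (1 : F))); rewrite addr0 -{3}[1]mulr1 dxM mulr1 mul1r. Qed.

Lemma dy1 (F : diffFieldType) : dy (1 : F) = 0.
Proof. by apply: (addrI (dy (1 : F))); rewrite addr0 -{3}[1]mulr1 dyM mulr1 mul1r. Qed.

(* Differential polynomials over F, as terms in countably many unknowns. *)
Inductive dterm (F : Type) : Type :=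
  | DConst of F
  | DVar of nat
  | DAdd of dterm F & dterm F
  | DMul of dterm F & dterm F
  | Ddx of dterm F
  | Ddy of dterm F.

Fixpoint deval (F : Type) (K : diffFieldType) (iota : F -> K) (v : nat -> K)
    (t : dterm F) : K :=
  match t with
  | DConst c => iota c
  | DVar i => v i
  | DAdd t1 t2 => deval iota v t1 + deval iota v t2
  | DMul t1 t2 => deval iota v t1 * deval iota v t2
  | Ddx t1 => dx (deval iota v t1)
  | Ddy t1 => dy (deval iota v t1)
  end.

Definition dsolves (F : Type) (K : diffFieldType) (iota : F -> K)
    (eqs neqs : seq (dterm F)) (v : nat -> K) : Prop :=
  all (fun t => deval iota v t == 0) eqs
  && all (fun t => deval iota v t != 0) neqs.

Definition diff_morphism (F K : diffFieldType) (iota : {rmorphism F -> K}) : Prop :=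
  forall f : F, iota (dx f) = dx (iota f) /\ iota (dy f) = dy (iota f).

(* Every finite system of differential polynomial equations and inequations
   over F that is solvable in a differential field extension is solvable in F. *)
Definition differentially_closed (F : diffFieldType) : Prop :=
  forall eqs neqs : seq (dterm F),
    (exists (K : diffFieldType) (iota : {rmorphism F -> K}),
        diff_morphism iota /\ exists v : nat -> K, dsolves iota eqs neqs v) ->
    exists v : nat -> F, dsolves (@id F) eqs neqs v.

(* F[d_x,d_y]: the polynomial \sum p_ij X_0^i X_1^j is the normal form of the
   operator \sum p_ij d_x^i d_y^j.  The wrapper keeps the commutative product
   of {mpoly F[2]} away from operators. *)
Record dop (F : diffFieldType) : Type := Dop { nf : {mpoly F[2]} }.

HB.instance Definition _ (F : diffFieldType) := [isNew for @nf F].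
HB.instance Definition _ (F : diffFieldType) := [Choice of dop F by <:].

Lemma nf_inj (F : diffFieldType) : injective (@nf F).
Proof. by move=> [p] [q] /= ->. Qed.

Definition dop_zero (F : diffFieldType) : dop F := Dop 0.
Definition dop_opp (F : diffFieldType) (u : dop F) : dop F := Dop (- nf u).
Definition dop_add (F : diffFieldType) (u v : dop F) : dop F := Dop (nf u + nf v).
Definition dop_scale (F : diffFieldType) (c : F) (u : dop F) : dop F :=
  Dop (c *: nf u).

Lemma dop_addA (F : diffFieldType) : associative (@dop_add F).
Proof. by move=> u v w; apply: nf_inj; exact: addrA. Qed.
Lemma dop_addC (F : diffFieldType) : commutative (@dop_add F).
Proof. by move=> u v; apply: nf_inj; exact: addrC. Qed.
Lemma dop_add0 (F : diffFieldType) : left_id (@dop_zero F) (@dop_add F).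
Proof. by move=> u; apply: nf_inj; exact: add0r. Qed.
Lemma dop_addN (F : diffFieldType) :
  left_inverse (@dop_zero F) (@dop_opp F) (@dop_add F).
Proof. by move=> u; apply: nf_inj; exact: addNr. Qed.

HB.instance Definition _ (F : diffFieldType) :=
  GRing.isZmodule.Build (dop F) (@dop_addA F) (@dop_addC F) (@dop_add0 F)
    (@dop_addN F).

Lemma dop_scaleA (F : diffFieldType) (a b : F) (u : dop F) :
  dop_scale a (dop_scale b u) = dop_scale (a * b) u.
Proof. by apply: nf_inj; exact: scalerA. Qed.
Lemma dop_scale1 (F : diffFieldType) : left_id 1 (@dop_scale F).
Proof. by move=> u; apply: nf_inj; exact: scale1r. Qed.
Lemma dop_scaleDr (F : diffFieldType) : right_distributive (@dop_scale F) +%R.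
Proof. by move=> a u v; apply: nf_inj; exact: scalerDr. Qed.
Lemma dop_scaleDl (F : diffFieldType) (u : dop F) :
  {morph (@dop_scale F)^~ u : a b / a + b}.
Proof. by move=> a b; apply: nf_inj; exact: scalerDl. Qed.

HB.instance Definition _ (F : diffFieldType) :=
  GRing.Zmodule_isLmodule.Build F (dop F) (@dop_scaleA F) (@dop_scale1 F)
    (@dop_scaleDr F) (@dop_scaleDl F).

Lemma nf_is_additive (F : diffFieldType) : zmod_morphism (@nf F).
Proof. by []. Qed.
HB.instance Definition _ (F : diffFieldType) :=
  GRing.isZmodMorphism.Build (dop F) {mpoly F[2]} (@nf F) (@nf_is_additive F).

Lemma nfZ (F : diffFieldType) (c : F) (u : dop F) : nf (c *: u) = c *: nf u.
Proof. by []. Qed.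

(* Left multiplication by d_x and d_y: d_x (q M) = q d_x M + d_x(q) M. *)
Definition dop_dx (F : diffFieldType) (u : dop F) : dop F :=
  Dop ('X_ord0 * nf u + map_mpoly (@dx F) (nf u)).
Definition dop_dy (F : diffFieldType) (u : dop F) : dop F :=
  Dop ('X_ord_max * nf u + map_mpoly (@dy F) (nf u)).

Definition dop_mon (F : diffFieldType) (m : 'X_{1..2}) (u : dop F) : dop F :=
  iter (m ord0) (@dop_dx F) (iter (m ord_max) (@dop_dy F) u).

Definition dop_one (F : diffFieldType) : dop F := Dop 1.
Definition dop_mul (F : diffFieldType) (u v : dop F) : dop F :=
  \sum_(m <- msupp (nf u)) (nf u)@_m *: dop_mon m v.

Lemma dop_dxB (F : diffFieldType) : zmod_morphism (@dop_dx F).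
Proof.
move=> u v; apply: nf_inj; rewrite [RHS]raddfB /= mulrBr raddfB /=.
by rewrite opprD addrACA.
Qed.
Lemma dop_dyB (F : diffFieldType) : zmod_morphism (@dop_dy F).
Proof.
move=> u v; apply: nf_inj; rewrite [RHS]raddfB /= mulrBr raddfB /=.
by rewrite opprD addrACA.
Qed.
HB.instance Definition _ (F : diffFieldType) :=
  GRing.isZmodMorphism.Build (dop F) (dop F) (@dop_dx F) (@dop_dxB F).
HB.instance Definition _ (F : diffFieldType) :=
  GRing.isZmodMorphism.Build (dop F) (dop F) (@dop_dy F) (@dop_dyB F).

Lemma dop_dxZ (F : diffFieldType) (c : F) (u : dop F) :
  dop_dx (c *: u) = c *: dop_dx u + dx c *: u.
Proof.
apply: nf_inj; rewrite raddfD /= ?nfZ /= -scalerAr scalerDr -addrA.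
congr (_ + _); apply/mpolyP => m.
by rewrite !(mcoeffD, mcoeffZ, mcoeff_map_mpoly) /= dxM addrC.
Qed.
Lemma dop_dyZ (F : diffFieldType) (c : F) (u : dop F) :
  dop_dy (c *: u) = c *: dop_dy u + dy c *: u.
Proof.
apply: nf_inj; rewrite raddfD /= ?nfZ /= -scalerAr scalerDr -addrA.
congr (_ + _); apply/mpolyP => m.
by rewrite !(mcoeffD, mcoeffZ, mcoeff_map_mpoly) /= dyM addrC.
Qed.

Lemma map_mpolyXM (F : diffFieldType) (f : {additive F -> F}) (m : 'X_{1..2})
    (p : {mpoly F[2]}) :
  map_mpoly f ('X_[m] * p) = 'X_[m] * map_mpoly f p.
Proof.
apply/mpolyP => k; rewrite mcoeff_map_mpoly !mcoeffM raddf_sum.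
apply: eq_bigr => k12 _; rewrite mcoeff_map_mpoly mcoeffX.
by case: (m == _); rewrite ?mul1r // !mul0r raddf0.
Qed.

Lemma dop_dxdyC (F : diffFieldType) (u : dop F) :
  dop_dx (dop_dy u) = dop_dy (dop_dx u).
Proof.
apply: nf_inj => /=; rewrite !raddfD /= !map_mpolyXM !mulrDr.
rewrite mulrCA -!addrA; congr (_ + _); rewrite addrCA; congr (_ + (_ + _)).
by apply/mpolyP => m; rewrite !mcoeff_map_mpoly /= dxdyC.
Qed.

Lemma dop_mon_is_additive (F : diffFieldType) (m : 'X_{1..2}) :
  zmod_morphism (@dop_mon F m).
Proof.
move=> u v; rewrite /dop_mon.
have -> n : iter n (@dop_dy F) (u - v) = iter n (@dop_dy F) u - iter n (@dop_dy F) v.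
  by elim: n => //= n ->; rewrite raddfB.
by elim: (m ord0) => //= n ->; rewrite raddfB.
Qed.
HB.instance Definition _ (F : diffFieldType) (m : 'X_{1..2}) :=
  GRing.isZmodMorphism.Build (dop F) (dop F) (@dop_mon F m)
    (@dop_mon_is_additive F m).

Lemma dop_mulE (F : diffFieldType) (s : seq 'X_{1..2}) (u v : dop F) :
  uniq s -> {subset msupp (nf u) <= s} ->
  dop_mul u v = \sum_(m <- s) (nf u)@_m *: dop_mon m v.
Proof.
move=> uniq_s sub_us; rewrite /dop_mul.
rewrite [RHS](bigID (mem (msupp (nf u)))) /= [X in _ + X]big1 ?addr0; last first.
  by move=> m /memN_msupp_eq0 ->; rewrite scale0r.
rewrite -[RHS]big_filter; apply: perm_big; apply: uniq_perm; rewrite ?filter_uniq //.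
by move=> m; rewrite mem_filter /=; case: (boolP (m \in msupp _)) => // /sub_us ->.
Qed.

Lemma dop_mulDl (F : diffFieldType) : left_distributive (@dop_mul F) +%R.
Proof.
move=> u v w.
pose s := undup (msupp (nf u) ++ msupp (nf v) ++ msupp (nf (u + v))).
rewrite !(@dop_mulE _ s) ?undup_uniq //;
  try by move=> m m_in; rewrite mem_undup !mem_cat m_in ?orbT.
rewrite -big_split; apply: eq_bigr => m _ /=.
by rewrite mcoeffD scalerDl.
Qed.

Lemma dop_mulDr (F : diffFieldType) : right_distributive (@dop_mul F) +%R.
Proof.
move=> u v w; rewrite /dop_mul -big_split; apply: eq_bigr => m _ /=.
by rewrite raddfD scalerDr.
Qed.

Lemma dop_mul_sum (F : diffFieldType) (I : Type) (r : seq I) (f : I -> dop F) v :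
  dop_mul (\sum_(i <- r) f i) v = \sum_(i <- r) dop_mul (f i) v.
Proof.
have z : dop_mul 0 v = 0 by rewrite /dop_mul /= msupp0 big_nil.
by elim: r => [|i r IH]; rewrite ?big_nil // !big_cons dop_mulDl IH.
Qed.

Lemma dop_scaleAl (F : diffFieldType) (c : F) (u v : dop F) :
  c *: dop_mul u v = dop_mul (c *: u) v.
Proof.
rewrite (@dop_mulE _ (msupp (nf u)) (c *: u)) ?msupp_uniq //.
  by rewrite scaler_sumr; apply: eq_bigr => m _; rewrite nfZ mcoeffZ scalerA.
by move=> m; rewrite nfZ => /msuppZ_le.
Qed.

Lemma dop_mul_mon (F : diffFieldType) (m : 'X_{1..2}) (v : dop F) :
  dop_mul (Dop 'X_[m]) v = dop_mon m v.
Proof. by rewrite /dop_mul /= msuppX big_seq1 mcoeffX eqxx scale1r. Qed.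

Lemma dop_mul1 (F : diffFieldType) : left_id (@dop_one F) (@dop_mul F).
Proof.
by move=> u; rewrite /dop_one -mpolyX0 dop_mul_mon /dop_mon !mnm0E.
Qed.

Lemma dop_sumE (F : diffFieldType) (u : dop F) :
  u = \sum_(m <- msupp (nf u)) (nf u)@_m *: Dop 'X_[m].
Proof. by apply: nf_inj; rewrite raddf_sum {1}[nf u]mpolyE. Qed.

Lemma map_mpolyX0 (F : diffFieldType) (f : {additive F -> F}) (m : 'X_{1..2}) :
  f 1 = 0 -> map_mpoly f 'X_[m] = 0.
Proof.
move=> f1; apply/mpolyP => k; rewrite mcoeff_map_mpoly /= mcoeffX mcoeff0.
by case: eqP; rewrite ?f1 ?raddf0.
Qed.

Lemma dop_dx_mon (F : diffFieldType) (m : 'X_{1..2}) :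
  dop_dx (Dop 'X_[m]) = Dop ('X_[U_(ord0) + m]) :> dop F.
Proof. by apply: nf_inj; rewrite /= (map_mpolyX0 _ (@dx1 F)) addr0 mpolyXD. Qed.
Lemma dop_dy_mon (F : diffFieldType) (m : 'X_{1..2}) :
  dop_dy (Dop 'X_[m]) = Dop ('X_[U_(ord_max) + m]) :> dop F.
Proof. by apply: nf_inj; rewrite /= (map_mpolyX0 _ (@dy1 F)) addr0 mpolyXD. Qed.

Lemma dop_mon1 (F : diffFieldType) (m : 'X_{1..2}) :
  dop_mon m (dop_one F) = Dop 'X_[m].
Proof.
rewrite /dop_mon /dop_one -mpolyX0.
have -> n : iter n (@dop_dy F) (Dop 'X_[0]) = Dop 'X_[U_(ord_max) *+ n].
  by elim: n => [|n IH] /=; rewrite ?mulm0n // IH dop_dy_mon mulmS.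
have -> k n : iter n (@dop_dx F) (Dop 'X_[k]) = Dop 'X_[U_(ord0) *+ n + k].
  by elim: n => [|n IH] /=; rewrite ?mulm0n ?add0m // IH dop_dx_mon mulmS addmA.
congr (Dop 'X_[_]); apply/mnmP => i.
rewrite mnmDE !mulmnE !mnm1E.
case: i => [[|[|//]] lti].
  rewrite (_ : Ordinal lti = ord0); last exact: val_inj.
  by rewrite eqxx /= mul1n mul0n addn0.
rewrite (_ : Ordinal lti = ord_max); last exact: val_inj.
by rewrite eqxx /= mul1n mul0n add0n.
Qed.

Lemma dop_mulr1 (F : diffFieldType) : right_id (@dop_one F) (@dop_mul F).
Proof.
move=> u; rewrite [RHS]dop_sumE; apply: eq_bigr => m _.
by rewrite dop_mon1.
Qed.

Lemma dop_dx_mul (F : diffFieldType) (u v : dop F) :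
  dop_mul (dop_dx u) v = dop_dx (dop_mul u v).
Proof.
rewrite {1}[u]dop_sumE raddf_sum dop_mul_sum /= [in RHS]/dop_mul raddf_sum.
apply: eq_bigr => m _ /=.
rewrite !dop_dxZ dop_mulDl -!dop_scaleAl dop_dx_mon !dop_mul_mon.
congr (_ *: _ + _); rewrite /dop_mon !mnmDE !mnm1E /=.
by [].
Qed.

Lemma dop_dy_mul (F : diffFieldType) (u v : dop F) :
  dop_mul (dop_dy u) v = dop_dy (dop_mul u v).
Proof.
rewrite {1}[u]dop_sumE raddf_sum dop_mul_sum /= [in RHS]/dop_mul raddf_sum.
apply: eq_bigr => m _ /=.
rewrite !dop_dyZ dop_mulDl -!dop_scaleAl dop_dy_mon !dop_mul_mon.
congr (_ *: _ + _); rewrite /dop_mon !mnmDE !mnm1E /= ?add0n ?add1n ?iterS.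
by elim: (m ord0) => //= n ->; rewrite dop_dxdyC.
Qed.

Lemma dop_mon_mul (F : diffFieldType) (m : 'X_{1..2}) (u v : dop F) :
  dop_mul (dop_mon m u) v = dop_mon m (dop_mul u v).
Proof.
rewrite /dop_mon; elim: (m ord0) => [|n IH] /=; last by rewrite dop_dx_mul IH.
by elim: (m ord_max) => //= n IH; rewrite dop_dy_mul IH.
Qed.

Lemma dop_mulA (F : diffFieldType) : associative (@dop_mul F).
Proof.
move=> u v w; rewrite [dop_mul u v]/dop_mul dop_mul_sum.
by apply: eq_bigr => m _; rewrite -dop_scaleAl dop_mon_mul.
Qed.

Lemma dop_one_neq0 (F : diffFieldType) : dop_one F != 0.
Proof. by apply/eqP => /(congr1 (@nf F)) /= /eqP; rewrite oner_eq0. Qed.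

HB.instance Definition _ (F : diffFieldType) :=
  GRing.Zmodule_isNzRing.Build (dop F) (@dop_mulA F) (@dop_mul1 F)
    (@dop_mulr1 F) (@dop_mulDl F) (@dop_mulDr F) (dop_one_neq0 F).
HB.instance Definition _ (F : diffFieldType) :=
  GRing.Lmodule_isLalgebra.Build F (dop F) (@dop_scaleAl F).

Definition Dx (F : diffFieldType) : dop F := Dop 'X_ord0.
Definition Dy (F : diffFieldType) : dop F := Dop 'X_ord_max.

(* The defining relations and the normal form, for the product just built;
   c%:A is the element c of F seen as an operator of order 0. *)
Lemma DxE (F : diffFieldType) (u : dop F) : Dx F * u = dop_dx u.
Proof. by rewrite /Dx [LHS]dop_mul_mon /dop_mon !mnm1E. Qed.
Lemma DyE (F : diffFieldType) (u : dop F) : Dy F * u = dop_dy u.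
Proof. by rewrite /Dy [LHS]dop_mul_mon /dop_mon !mnm1E. Qed.

Lemma DxDyC (F : diffFieldType) : Dx F * Dy F = Dy F * Dx F.
Proof. by rewrite DxE DyE -[Dy F]mulr1 DyE dop_dxdyC -DxE mulr1. Qed.

Lemma Dx_comm (F : diffFieldType) (f : F) :
  Dx F * f%:A = f%:A * Dx F + (dx f)%:A.
Proof. by rewrite DxE dop_dxZ -DxE mulr1 -scalerAl mul1r. Qed.

Lemma Dy_comm (F : diffFieldType) (f : F) :
  Dy F * f%:A = f%:A * Dy F + (dy f)%:A.
Proof. by rewrite DyE dop_dyZ -DyE mulr1 -scalerAl mul1r. Qed.

Lemma dop_normal_form (F : diffFieldType) (u : dop F) :
  u = \sum_(m <- msupp (nf u)) (nf u)@_m *: (Dx F ^+ m ord0 * Dy F ^+ m ord_max).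
Proof.
rewrite {1}[u]dop_sumE; apply: eq_bigr => m _; congr (_ *: _).
rewrite -dop_mon1 /dop_mon.
have hy n w : iter n (@dop_dy F) w = Dy F ^+ n * w.
  by elim: n => [|n IH] /=; rewrite ?mul1r // IH exprS -mulrA DyE.
have hx n w : iter n (@dop_dx F) w = Dx F ^+ n * w.
  by elim: n => [|n IH] /=; rewrite ?mul1r // IH exprS -mulrA DxE.
by rewrite hx hy -[dop_one F]/(1 : dop F) mulr1.
Qed.

(* msize is degree + 1; in particular ord 0 = 0 and symb 0 = 0. *)
Definition ord (F : diffFieldType) (u : dop F) : nat := (msize (nf u)).-1.

Definition symb (F : diffFieldType) (u : dop F) : {mpoly F[2]} :=
  pihomog mdeg (ord u) (nf u).

Definition mpoly_dvd (F : fieldType) (f g : {mpoly F[2]}) : Prop :=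
  exists q : {mpoly F[2]}, g = q * f.

Definition separable (F : fieldType) (f : {mpoly F[2]}) : Prop :=
  forall a b : F, (a, b) != (0, 0) ->
    ~ mpoly_dvd ((a *: 'X_ord0 + b *: 'X_ord_max) ^+ 2) f.

Definition subideal (F : diffFieldType) (I J : dop F -> Prop) : Prop :=
  forall u, I u -> J u.

Definition same_ideal (F : diffFieldType) (I J : dop F -> Prop) : Prop :=
  forall u, I u <-> J u.

Definition left_ideal (F : diffFieldType) (I : dop F -> Prop) : Prop :=
  [/\ I 0, (forall u v, I u -> I v -> I (u + v))
    & (forall a u, I u -> I (a * u))].

Definition principal (F : diffFieldType) (P : dop F) : dop F -> Prop :=
  fun u => exists a : dop F, u = a * P.

(* The image in F[d_x,d_y]/I of the operators of order at most z has
   F-dimension d: the classes of b_0, ..., b_(d-1) form a basis of it. *)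
Definition image_dim (F : diffFieldType) (I : dop F -> Prop) (z d : nat) : Prop :=
  exists b : 'I_d -> dop F,
    [/\ forall i, (ord (b i) <= z)%N,
        forall u, (ord u <= z)%N -> exists c : 'I_d -> F, I (u - \sum_i c i *: b i)
      & forall c : 'I_d -> F, I (\sum_i c i *: b i) -> forall i, c i = 0].

Definition hilbert_kolchin (F : diffFieldType) (I : dop F -> Prop)
    (p : {poly rat}) : Prop :=
  exists z0 : nat, forall z : nat, (z0 <= z)%N ->
    exists d : nat, image_dim I z d /\ p.[z%:R] = d%:R.

Definition nonholonomic (F : diffFieldType) (I : dop F -> Prop) : Prop :=
  exists p : {poly rat}, hilbert_kolchin I p /\ size p = 2%N.

Definition symb_ideal (F : diffFieldType) (I : dop F -> Prop)
    (f : {mpoly F[2]}) : Prop :=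
  exists (k : nat) (q : 'I_k -> {mpoly F[2]}) (u : 'I_k -> dop F),
    (forall i, I (u i)) /\ f = \sum_i q i * symb (u i).

Definition is_gcd (F : fieldType) (S : {mpoly F[2]} -> Prop)
    (g : {mpoly F[2]}) : Prop :=
  (forall f, S f -> mpoly_dvd g f) /\
  (forall h, (forall f, S f -> mpoly_dvd h f) -> mpoly_dvd h g).

(* A relation, since the gcd is defined up to a nonzero factor in F. *)
Definition attached (F : diffFieldType) (I : dop F -> Prop)
    (g : {mpoly F[2]}) : Prop :=
  (exists d, g \is d.-homog) /\ is_gcd (symb_ideal I) g.

Definition nonholonomic_over (F : diffFieldType) (J I : dop F -> Prop) : Prop :=
  [/\ left_ideal I, subideal J I & nonholonomic I].

Definition maximal_among (F : diffFieldType) (C : (dop F -> Prop) -> Prop)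
    (I : dop F -> Prop) : Prop :=
  C I /\ forall K, C K -> subideal I K -> subideal K I.

(* The M i need not satisfy C, nor be pairwise distinct. *)
Definition at_most (F : diffFieldType) (n : nat)
    (C : (dop F -> Prop) -> Prop) : Prop :=
  exists M : 'I_n -> (dop F -> Prop),
    forall I, C I -> exists i, same_ideal I (M i).

(* Main.v *)
Require Import Defs.
From Stdlib Require Import Classical ClassicalEpsilon.
From HB Require Import structures.
From mathcomp Require Import all_boot all_order all_algebra qfpoly zify ring.

Set Implicit Arguments.
Unset Strict Implicit.
Unset Printing Implicit Defensive.

Import GRing.Theory Num.Theory.
Local Open Scope ring_scope.

(** The symbol of [P] is a constant times a product of linear forms [lin c],
    where [c] runs over its zeros on the projective line, because a
    differentially closed field is algebraically closed
    ([differentially_closed_algebraically_closed]), and separability says that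
    the zeros are pairwise distinct.  For a left ideal [I] containing [P], let
    [A(I)] be the set of those zeros at which all symbols of elements of [I]
    vanish.  Everything is governed by [A(I)], for two reasons.

    First, in large degree the forms occurring as leading parts of elements of
    [I] are exactly the forms vanishing on [A(I)] ([leading_form_large]).
    Hence the Hilbert function of [I] is eventually linear with slope the
    cardinal of [A(I)], so that [I] is non-holonomic iff [A(I)] is not empty
    ([nonholonomicP]), and the attached polynomial of [I] is the product of the
    [lin c] for [c] in [A(I)] ([attached_common_zeros]).

    Second, for every zero [c] there is a largest left ideal [L_c] among those
    that contain [P] and whose symbols all vanish at [c].  The operators whose
    symbol does not vanish at [c] satisfy the Ore condition up to terms of
    arbitrarily small order ([approximate_ore]), which allows one to localize.
    Let [L_c] consist of the [u] such that, for every [k], some such operator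
    [s] makes [s * u] congruent modulo [<P>] to an operator of order at most
    [ord s - k] ([local_ideal]).  This is a left ideal ([left_ideal_local]),
    its symbols vanish at [c] ([local_ideal_irregular]), and it contains the
    competing ideals: as [c] is a simple zero of the symbol of [P], in the
    localized symbol ring every symbol vanishing at [c] is a multiple of that
    of [P], so an element can be reduced modulo [P] again and again
    ([local_ideal_largest]).

    A maximal non-holonomic overideal has some [c] in its zero set, lies in
    [L_c], which is itself non-holonomic, and hence equals [L_c]; there are at
    most [ord P] choices for [c].  If [I] has attached polynomial [g], the
    intersection of the [L_c] for [c] in [A(I)] also has attached polynomial
    [g], and it contains every overideal with attached polynomial [g]. *)

(** * Adjoining roots to differential fields *)

Section AdjoinRoot.

(* [K] is the quotient of [{poly F}] by the ideal of [p]. *)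

Variables (F : diffFieldType) (p : {poly F}) (K : fieldType).
Variables (pi : {rmorphism {poly F} -> K}) (rep : K -> {poly F}).
Hypothesis repK : cancel rep pi.
Hypothesis pi_eq0 : forall q, pi q = 0 <-> p %| q.
Hypothesis pi_dp : pi p^`() != 0.

Section Extension.

Variable delta : {additive F -> F}.
Hypothesis deltaM : forall a b, delta (a * b) = delta a * b + a * delta b.

Lemma map_poly_derivM (q r : {poly F}) :
  map_poly delta (q * r) = map_poly delta q * r + q * map_poly delta r.
Proof.
apply/polyP => i; rewrite coefD coef_map !coefM raddf_sum -big_split /=.
by apply: eq_bigr => j _; rewrite !coef_map deltaM.
Qed.

(** The value at the root that the derivation must take, read off from
    applying it to [p]. *)
Definition root_deriv : K := - pi (map_poly delta p) / pi p^`().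

Definition poly_deriv (q : {poly F}) : K :=
  pi (map_poly delta q) + pi q^`() * root_deriv.

Definition ext_deriv (k : K) : K := poly_deriv (rep k).

Lemma poly_derivD q r : poly_deriv (q + r) = poly_deriv q + poly_deriv r.
Proof. by rewrite /poly_deriv derivD !raddfD /= mulrDl addrACA. Qed.

Lemma poly_derivM q r :
  poly_deriv (q * r) = poly_deriv q * pi r + pi q * poly_deriv r.
Proof.
rewrite /poly_deriv derivM map_poly_derivM !rmorphD !rmorphM /=; ring.
Qed.

Lemma poly_deriv_root : poly_deriv p = 0.
Proof. by rewrite /poly_deriv /root_deriv mulrCA divff // mulr1 subrr. Qed.

(** [poly_deriv] descends to the quotient because it kills [p]. *)
Lemma ext_derivE q : ext_deriv (pi q) = poly_deriv q.
Proof.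
have /pi_eq0/dvdpP[h hE] : pi (q - rep (pi q)) = 0.
  by rewrite raddfB /= repK subrr.
have pip : pi p = 0 by apply/pi_eq0.
rewrite -{2}[q](subrK (rep (pi q))) poly_derivD hE poly_derivM.
by rewrite poly_deriv_root pip !mulr0 !add0r.
Qed.

Lemma ext_derivD k l : ext_deriv (k + l) = ext_deriv k + ext_deriv l.
Proof. by rewrite -[k]repK -[l]repK -raddfD !ext_derivE poly_derivD. Qed.

Lemma ext_derivM k l : ext_deriv (k * l) = ext_deriv k * l + k * ext_deriv l.
Proof. by rewrite -[k]repK -[l]repK -rmorphM !ext_derivE poly_derivM. Qed.

Lemma ext_derivC c : ext_deriv (pi c%:P) = pi (delta c)%:P.
Proof. by rewrite ext_derivE /poly_deriv derivC rmorph0 mul0r addr0 map_polyC. Qed.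

End Extension.

(** The commutator of two derivations is a derivation; it vanishes on [F],
    hence also at the root of the separable polynomial [p]. *)
Lemma ext_deriv_comm (d1 d2 : {additive F -> F}) :
  (forall a b, d1 (a * b) = d1 a * b + a * d1 b) ->
  (forall a b, d2 (a * b) = d2 a * b + a * d2 b) ->
  (forall a, d1 (d2 a) = d2 (d1 a)) ->
  forall k, ext_deriv d1 (ext_deriv d2 k) = ext_deriv d2 (ext_deriv d1 k).
Proof.
move=> d1M d2M d12.
pose C k := ext_deriv d1 (ext_deriv d2 k) - ext_deriv d2 (ext_deriv d1 k).
have CD k l : C (k + l) = C k + C l.
  by rewrite /C !(ext_derivD d1M, ext_derivD d2M); ring.
have CM k l : C (k * l) = C k * l + k * C l.
  rewrite /C !(ext_derivM d1M, ext_derivM d2M, ext_derivD d1M, ext_derivD d2M).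
  by ring.
have CC c : C (pi c%:P) = 0.
  by rewrite /C !(ext_derivC d1M, ext_derivC d2M) d12 subrr.
have CE q : C (pi q) = pi q^`() * C (pi 'X).
  elim/poly_ind: q => [|q c IH].
    by rewrite -polyC0 CC derivC rmorph0 mul0r.
  rewrite derivMXaddC rmorphD CD CC addr0 rmorphM CM IH rmorphD rmorphM.
  by rewrite mulrDl addrC mulrAC.
have CX : C (pi 'X) = 0.
  have pip : pi p = 0 by apply/pi_eq0.
  have C0 : C 0 = 0 by have := CC 0; rewrite polyC0 rmorph0.
  have /esym/eqP := CE p; rewrite pip C0 mulf_eq0 (negPf pi_dp) /=.
  by move/eqP.
by move=> k; apply/eqP; rewrite -subr_eq0 -[k]repK -/(C _) CE CX mulr0.
Qed.

End AdjoinRoot.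

(** A copy of [K] that carries the data on which its derivations depend. *)
Definition adjoin_root (F : diffFieldType) (p : {poly F}) (K : fieldType)
    (pi : {rmorphism {poly F} -> K}) (rep : K -> {poly F})
    (repK : cancel rep pi) (pi_eq0 : forall q, pi q = 0 <-> p %| q)
    (pi_dp : pi p^`() != 0) : Type := K.

Section AdjoinRootInstance.

Variables (F : diffFieldType) (p : {poly F}) (K : fieldType).
Variables (pi : {rmorphism {poly F} -> K}) (rep : K -> {poly F}).
Hypothesis repK : cancel rep pi.
Hypothesis pi_eq0 : forall q, pi q = 0 <-> p %| q.
Hypothesis pi_dp : pi p^`() != 0.

Local Notation L := (adjoin_root repK pi_eq0 pi_dp).
Let dxA := @dxM F.
Let dyA := @dyM F.

HB.instance Definition _ := GRing.Field.on L.
HB.instance Definition _ := Field_hasTwoDerivations.Build L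
  (ext_derivD repK pi_eq0 pi_dp (delta := @dx F) dxA)
  (ext_derivD repK pi_eq0 pi_dp (delta := @dy F) dyA)
  (ext_derivM repK pi_eq0 pi_dp (delta := @dx F) dxA)
  (ext_derivM repK pi_eq0 pi_dp (delta := @dy F) dyA)
  (ext_deriv_comm repK pi_eq0 pi_dp (d1 := @dx F) (d2 := @dy F) dxA dyA (@dxdyC F)).

(** The class of the variable is a root of [p] in [K], to which both derivations
    of [F] extend. *)
Lemma diff_field_root :
  exists (K' : diffFieldType) (iota : {rmorphism F -> K'}),
    diff_morphism iota /\ exists x : K', root (map_poly iota p) x.
Proof.
exists (L : diffFieldType), (pi \o polyC : {rmorphism F -> K}); split.
  move=> f; split; rewrite /= /dx /dy /=.
    by rewrite (ext_derivC repK pi_eq0 pi_dp (delta := @dx F) dxA).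
  by rewrite (ext_derivC repK pi_eq0 pi_dp (delta := @dy F) dyA).
exists (pi 'X : K); rewrite /root.
have -> : (map_poly (pi \o polyC) p).[pi 'X] = pi p.
  rewrite (map_poly_comp pi polyC) horner_map /=.
  by rewrite -[map_poly polyC p]/(p^:P) -[_.['X]]/(p \Po 'X) comp_polyXr.
by apply/eqP/pi_eq0.
Qed.

End AdjoinRootInstance.

Definition algebraically_closed (F : fieldType) : Prop :=
  forall p : {poly F}, (1 < size p)%N -> exists x, root p x.

(** Horner's scheme. *)
Definition dterm_of_seq (F : fieldType) (s : seq F) : dterm F :=
  foldr (fun c t => DAdd (DMul t (DVar F 0)) (DConst c)) (DConst 0) s.

Lemma deval_dterm_of_seq (F : fieldType) (K : diffFieldType)
    (iota : {rmorphism F -> K}) v (s : seq F) :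
  deval iota v (dterm_of_seq s) = (Poly (map iota s)).[v 0%N].
Proof.
elim: s => [|c s IH] /=; first by rewrite rmorph0 horner0.
by rewrite IH horner_cons.
Qed.

(** A polynomial equation is in particular a differential one, so it is enough
    to solve it in some differential extension; a polynomial of least size
    without root would be irreducible, and in characteristic zero its roots
    are simple. *)
Lemma differentially_closed_algebraically_closed (F : diffFieldType) :
  [pchar F] =i pred0 -> differentially_closed F -> algebraically_closed F.
Proof.
move=> char0 dcF.
have solve (p : {poly F}) (K : diffFieldType) (iota : {rmorphism F -> K}) :
    diff_morphism iota -> (exists x, root (map_poly iota p) x) ->
    exists x, root p x.
  move=> iotaD [x px].
  have [|v] := dcF [:: dterm_of_seq p] [::].
    exists K, iota; split=> //; exists (fun=> x).
    by rewrite /dsolves /= !andbT deval_dterm_of_seq -map_polyE.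
  rewrite /dsolves /= !andbT.
  rewrite (@deval_dterm_of_seq F F idfun) map_id polyseqK => pv.
  by exists (v 0%N).
move=> p; have [n] := ubnP (size p); elim: n p => // n IH p.
rewrite ltnS => pn p_gt1.
have p0 : p != 0 by rewrite -size_poly_gt0; lia.
have [[q /and3P[q1 qp nqp]]|noq] :=
    classic (exists q : {poly F}, [&& size q != 1%N, q %| p & ~~ (q %= p)]).
  have q0 : q != 0 by apply: contraTneq qp => ->; rewrite dvd0p.
  have qn : (size q < n)%N.
    apply: leq_trans pn; rewrite ltn_neqAle dvdp_leq // andbT.
    by apply: contra nqp => /eqP qp_size; rewrite -dvdp_size_eqp // qp_size.
  have q_gt1 : (1 < size q)%N by move: q0 q1; rewrite -size_poly_gt0; lia.
  have [x qx] := IH q qn q_gt1.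
  by exists x; move: qx; rewrite -!dvdp_XsubCl => /dvdp_trans; apply.
have lc0 : lead_coef p != 0 by rewrite lead_coef_eq0.
pose q := (lead_coef p)^-1 *: p.
have qp : q %= p by rewrite eqp_scale // invr_eq0.
have q_monic : q \is monic by rewrite monicE lead_coefZ mulVf.
have irr : monic_irreducible_poly q.
  split=> //; split; first by rewrite (eqp_size qp).
  move=> r r1; rewrite (eqp_dvdr _ qp) (eqp_rtrans qp) => rp.
  by apply: NNPP => nrp; apply: noq; exists r; rewrite r1 rp; apply/negP.
have qE : mk_monic q = q by exact: mk_monicE irr.
pose K : fieldType := {poly %/ q with irr}.
pose pi : {rmorphism {poly F} -> K} := (in_qpoly q : {rmorphism _ -> {poly %/ q}}).
have pi_eq0 r : pi r = 0 <-> q %| r.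
  rewrite /dvdp Pdiv.IdomainMonic.modpE //.
  split=> [/(congr1 (@polyn _ _))|/eqP rq]; last apply: val_inj; by rewrite /= qE // => ->.
have repK : cancel (@polyn F _ : K -> {poly F}) pi.
  by move=> k; apply: val_inj; rewrite /= Pdiv.CommonRing.rmodp_small ?size_mk_monic.
have pi_dq : pi q^`() != 0.
  have q_gt1 : (1 < size q)%N by rewrite (eqp_size qp).
  have q0 : q != 0 by rewrite -size_poly_gt0 ltnW.
  have dq0 : q^`() != 0.
    apply/eqP => /(congr1 (fun r : {poly F} => r`_(size q).-2)) /eqP.
    rewrite coef0 coef_deriv.
    have -> : (size q).-2.+1 = (size q).-1 by lia.
    rewrite -/(lead_coef q) (eqP q_monic) (pcharf0P F).1 //; lia.
  by apply/eqP => /pi_eq0 /(dvdp_leq dq0); rewrite leqNgt lt_size_deriv.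
have [K' [iota [iotaD xr]]] := diff_field_root repK pi_eq0 pi_dq.
have [x qx] := solve q K' iota iotaD xr.
by exists x; rewrite -(eqp_root qp).
Qed.

(** * Binary forms and points of the projective line *)

Section BinaryForms.

Variable F : fieldType.
Implicit Types (f g h q : {mpoly F[2]}) (c : F * F) (d e z : nat) (s : seq (F * F)).

(** Homogeneous coordinates of a point of the projective line. *)
Definition coord c (i : 'I_2) : F := if i == ord0 then c.1 else c.2.

(** The linear form, unique up to a factor, that vanishes at [c]. *)
Definition lin c : {mpoly F[2]} := c.2 *: 'X_ord0 - c.1 *: 'X_ord_max.

(** For nonzero vectors: they are coordinates of distinct points. *)
Definition apart c c' : bool := c.2 * c'.1 != c.1 * c'.2.

Lemma lin_at c c' : (lin c).@[coord c'] = c.2 * c'.1 - c.1 * c'.2.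
Proof. by rewrite mevalB !mevalZ !mevalXU. Qed.

Lemma lin_at_apart c c' : ((lin c).@[coord c'] != 0) = apart c c'.
Proof. by rewrite lin_at subr_eq0. Qed.

Lemma apart_sym c c' : apart c c' = apart c' c.
Proof. by rewrite /apart eq_sym [in LHS]mulrC [X in _ != X]mulrC. Qed.

Lemma coord_neq0 c : c != 0 -> exists i, coord c i != 0.
Proof.
case: c => a b; rewrite xpair_eqE negb_and => /orP[a0|b0].
  by exists ord0.
by exists ord_max.
Qed.

Lemma lin_neq0 c : c != 0 -> lin c != 0.
Proof.
case: c => a b; apply: contraNneq => c0.
have at0 c' : (lin (a, b)).@[coord c'] = 0 by rewrite c0 meval0.
have /eqP := at0 (1, 0); have /eqP := at0 (0, 1); rewrite !lin_at /=.
by rewrite !mulr0 !mulr1 sub0r subr0 oppr_eq0 => /eqP -> /eqP ->.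
Qed.

Lemma varX_homog i : ('X_i : {mpoly F[2]}) \is 1.-homog.
Proof. by rewrite dhomogX /= mdeg1. Qed.

Lemma lin_homog c : lin c \is 1.-homog.
Proof. by apply: rpredB; apply: rpredZ; apply: varX_homog. Qed.

Lemma mcoeff_pihomog d f m :
  (pihomog mdeg d f)@_m = if mdeg m == d then f@_m else 0.
Proof.
case: eqP => [md|/eqP md]; last exact: dhomog_nemf_coeff (pihomogP mdeg d f) md.
rewrite {2}(pihomog_partitionE (leqnn (mmeasure mdeg f))) [in RHS]raddf_sum /=.
have [dk|dk] := ltnP d (msize f); last first.
  have -> : pihomog mdeg d f = 0.
    rewrite pihomogE big_seq_cond big_pred0 // => m'; apply/negP.
    by move=> /andP[/msize_mdeg_lt m'f /eqP m'd]; move: (leq_trans m'f dk); rewrite -m'd ltnn.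
  rewrite mcoeff0 big1 // => i _; apply: dhomog_nemf_coeff (pihomogP mdeg i f) _.
  by rewrite /= md gtn_eqF // (leq_trans (ltn_ord i)).
rewrite (bigD1 (Ordinal dk)) //= big1 ?addr0 // => i ik.
by apply: dhomog_nemf_coeff (pihomogP mdeg i f) _; rewrite /= md eq_sym.
Qed.

Lemma msize_leP f d :
  reflect (forall m, (d <= mdeg m)%N -> f@_m = 0) (msize f <= d)%N.
Proof.
apply: (iffP idP) => [fd m dm|f0].
  by apply/memN_msupp_eq0/msize_mdeg_ge/(leq_trans fd).
rewrite msizeE; apply/bigmax_leqP_seq => m; rewrite mcoeff_msupp => fm _.
by rewrite ltnNge; apply: contra fm => /f0 ->.
Qed.

Lemma pihomogM_homog f g d e : g \is e.-homog ->
  pihomog mdeg (d + e) (f * g) = pihomog mdeg d f * g.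
Proof.
move=> ge; set k := maxn (msize f) d.+1.
rewrite {1}(pihomog_partitionE (leq_maxl _ _ : (mmeasure mdeg f <= k)%N)).
have dk : (d < k)%N by rewrite leq_max leqnn orbT.
rewrite mulr_suml raddf_sum (bigD1 (Ordinal dk)) //= big1 ?addr0.
  by rewrite (pihomog_dE (dhomogM (pihomogP mdeg d f) ge)).
move=> i id; apply: pihomog_ne0 (dhomogM (pihomogP mdeg i f) ge).
by rewrite eqn_add2r; apply: contra id => /eqP di; apply/eqP/val_inj.
Qed.

(** A quotient of homogeneous polynomials can be taken homogeneous: keep the
    component of the right degree. *)
Lemma homog_quotient f g q d e :
  f \is d.-homog -> g \is e.-homog -> f = q * g ->
  exists2 q', q' \is (d - e).-homog & f = q' * g.
Proof.
move=> fd ge fE; set k := msize q.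
exists (\sum_(i < k | (i + e)%N == d) pihomog mdeg i q).
  by apply: rpred_sum => i /eqP <-; rewrite addnK pihomogP.
rewrite -(pihomog_dE fd) {1}fE {1}(pihomog_partitionE (leqnn k)) mulr_suml.
rewrite raddf_sum [in RHS]big_mkcond mulr_suml; apply: eq_bigr => i _ /=.
have qg := dhomogM (pihomogP mdeg i q) ge.
case: eqP => [<-|/eqP ne]; first by rewrite (pihomog_dE qg).
by rewrite mul0r (pihomog_ne0 _ qg).
Qed.

(** Modulo [lin c] every variable is a multiple of one for which the
    coordinate of [c] does not vanish, so a form [f] of degree [d] reduces to
    a multiple of the [d]-th power of that variable; both have the same value
    at [c], so this multiple is zero when [f] vanishes there. *)
Lemma lin_dvdP c f d : c != 0 -> f \is d.-homog -> f.@[coord c] = 0 ->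
  exists2 q, q \is (d.-1).-homog & f = q * lin c.
Proof.
move=> /coord_neq0[i ci] fd fc.
suff [q fE] : exists q, f = q * lin c.
  by have [q' q'd ->] := homog_quotient fd (lin_homog c) fE; exists q'; rewrite -?subn1.
pose eqm g h := exists q, g - h = q * lin c.
have eqmM g1 h1 g2 h2 : eqm g1 h1 -> eqm g2 h2 -> eqm (g1 * g2) (h1 * h2).
  move=> [q1 q1E] [q2 q2E]; exists (q1 * g2 + h1 * q2).
  by rewrite mulrDl mulrAC -q1E -mulrA -q2E; ring.
have eqm_refl g : eqm g g by exists 0; rewrite subrr mul0r.
have eqmX g h n : eqm g h -> eqm (g ^+ n) (h ^+ n).
  by move=> gh; elim: n => // n IH; rewrite !exprS; apply: eqmM.
have eqm_var j : eqm 'X_j ((coord c j / coord c i) *: 'X_i).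
  have [<-|ij] := eqVneq i j; first by rewrite divff // scale1r.
  exists (((if i == ord0 then -1 else 1) / coord c i)%:MP).
  rewrite mul_mpolyC; apply: (scalerI ci); rewrite scalerBr !scalerA.
  rewrite [_ * (_ / _)]mulrC divfK // [_ * (_ / _)]mulrC divfK //.
  move: i j ij {ci eqm_refl eqmX eqmM eqm}.
  case=> [[|[|//]] lti]; case=> [[|[|//]] ltj] //= _.
  - rewrite /coord /= scaleN1r /lin opprB.
    by congr (_ *: 'X_ _ - _ *: 'X_ _); apply: val_inj.
  - rewrite /coord /= scale1r /lin.
    by congr (_ *: 'X_ _ - _ *: 'X_ _); apply: val_inj.
have eqm_mon (m : 'X_{1..2}) : mdeg m = d ->
    eqm 'X_[m] (('X_[m].@[coord c] / coord c i ^+ d) *: 'X_i ^+ d).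
  move=> md.
  have -> : ('X_[m].@[coord c] / coord c i ^+ d) *: 'X_i ^+ d =
      \prod_j ((coord c j / coord c i) *: ('X_i : {mpoly F[2]})) ^+ m j.
    under [in RHS]eq_bigr do rewrite exprZn expr_div_n.
    by rewrite scaler_prod prodf_div -mevalX !prodrXr -mdegE md.
  rewrite mpolyXE_id; apply: (big_ind2 eqm) => // j _; exact: eqmX.
have eqm_sum (r : seq 'X_{1..2}) (G H : 'X_{1..2} -> {mpoly F[2]}) :
    (forall m, m \in r -> eqm (G m) (H m)) ->
    eqm (\sum_(m <- r) G m) (\sum_(m <- r) H m).
  elim: r => [|m r IH] GH; first by rewrite !big_nil.
  have [q1 q1E] := GH m (mem_head _ _).
  have [m' m'r|q2 q2E] := IH; first by apply: GH; rewrite in_cons m'r orbT.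
  by exists (q1 + q2); rewrite !big_cons mulrDl -q1E -q2E; ring.
have [q qE] : eqm f ((f.@[coord c] / coord c i ^+ d) *: 'X_i ^+ d).
  rewrite {1 2}[f]mpolyE raddf_sum mulr_suml scaler_suml.
  apply: eqm_sum => m mf /=; rewrite mevalZ -mulrA -scalerA.
  have [q qE] := eqm_mon m (dhomog_mf fd mf).
  by exists (f@_m *: q); rewrite -scalerBr qE scalerAl.
by exists q; rewrite -qE fc mul0r scale0r subr0.
Qed.

Definition prod_lin s : {mpoly F[2]} := \prod_(c <- s) lin c.

Lemma prod_lin_homog s : prod_lin s \is (size s).-homog.
Proof.
elim: s => [|c s IH]; rewrite /prod_lin ?big_nil ?big_cons /= ?dhomog1 //.
exact: dhomogM (lin_homog c) IH.
Qed.

Lemma prod_lin_at_neq0 s c :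
  ((prod_lin s).@[coord c] != 0) = all (fun c' => apart c' c) s.
Proof.
elim: s => [|c' s IH]; rewrite /prod_lin ?big_nil ?meval1 ?oner_eq0 //=.
by rewrite big_cons mevalM mulf_eq0 negb_or lin_at_apart IH.
Qed.

Lemma prod_lin_at_mem s c : c \in s -> (prod_lin s).@[coord c] = 0.
Proof.
move=> cs; apply/eqP/negbNE; rewrite prod_lin_at_neq0; apply/allPn; exists c => //.
by rewrite /apart negbK mulrC.
Qed.

Definition all_apart s : bool := pairwise apart s && all (fun c => c != 0) s.

Lemma all_apart_cons c s :
  all_apart (c :: s) = [&& all (apart c) s, c != 0 & all_apart s].
Proof. by rewrite /all_apart /= andbACA !andbA. Qed.

Lemma all_apart_filter (a : pred (F * F)) s : all_apart s -> all_apart (filter a s).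
Proof.
case/andP=> ps s0; apply/andP; split; first exact: subseq_pairwise (filter_subseq a s) ps.
by apply/allP => c; rewrite mem_filter => /andP[_] /(allP s0).
Qed.

(** Linear forms at distinct points are coprime: once the others are divided
    out, the quotient still vanishes at the remaining point. *)
Lemma prod_lin_dvdP s f d : all_apart s -> f \is d.-homog ->
  (forall c, c \in s -> f.@[coord c] = 0) ->
  exists2 q, q \is (d - size s).-homog & f = q * prod_lin s.
Proof.
elim: s => [|c s IH] in d f *.
  by move=> _ fd _; exists f; rewrite ?subn0 // /prod_lin big_nil mulr1.
rewrite all_apart_cons => /and3P[cs c0 s_apart] fd f0.
have [|q qd fE] := IH d f s_apart fd.
  by move=> c' c's; apply: f0; rewrite in_cons c's orbT.
have qc : q.@[coord c] = 0.
  have /eqP := f0 c (mem_head _ _); rewrite fE mevalM mulf_eq0 => /orP[/eqP//|].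
  rewrite (negPf (_ : _ != 0)) // prod_lin_at_neq0.
  by apply: sub_all cs => c'; rewrite apart_sym.
have [q' q'd qE] := lin_dvdP c0 qd qc.
exists q'; first by rewrite /= subnS.
by rewrite fE qE /prod_lin big_cons mulrA.
Qed.

Lemma homog_unit_at c k : c != 0 ->
  exists2 h, h \is k.-homog & h.@[coord c] = 1.
Proof.
move=> /coord_neq0[i ci]; exists ((coord c i ^+ k)^-1 *: 'X_i ^+ k).
  by apply: rpredZ; have := dhomogMn k (varX_homog i); rewrite mul1n.
by rewrite mevalZ rmorphXn /= mevalXU mulVf // expf_neq0.
Qed.

(** Lagrange interpolation on the projective line. *)
Lemma lagrange_forms s z : all_apart s -> (size s <= z.+1)%N ->
  exists L : 'I_(size s) -> {mpoly F[2]},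
    [/\ forall i : 'I_(size s), L i \is z.-homog,
        forall i : 'I_(size s), (L i).@[coord (nth 0 s i)] = 1
      & forall i j : 'I_(size s), i != j -> (L i).@[coord (nth 0 s j)] = 0].
Proof.
move=> s_apart s_z.
have ex (i : 'I_(size s)) : exists Li, [/\ Li \is z.-homog,
    Li.@[coord (nth 0 s i)] = 1
  & forall j : 'I_(size s), i != j -> Li.@[coord (nth 0 s j)] = 0].
  pose s' := take i s ++ drop i.+1 s; pose c := nth 0 s i.
  have s'_size : size s' = (size s).-1.
    by rewrite size_cat size_take size_drop ltn_ord; have := ltn_ord i; lia.
  have c0 : c != 0 by case/andP: s_apart => _ /allP; apply; rewrite mem_nth.
  have s_split : s = take i s ++ c :: drop i.+1 s.
    by rewrite -drop_nth // cat_take_drop.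
  have s'c : (prod_lin s').@[coord c] != 0.
    rewrite prod_lin_at_neq0 /s' all_cat.
    case/andP: s_apart; rewrite {1}s_split pairwise_cat /= allrel_consr.
    move=> /and3P[/andP[tc _] _ /andP[cd _]] _.
    by rewrite tc /=; apply: sub_all cd => c'; rewrite apart_sym.
  have [h hz hc] := @homog_unit_at c (z - size s') c0.
  (* [h] only serves to raise the degree to [z]. *)
  exists (((prod_lin s').@[coord c])^-1 *: (h * prod_lin s')); split.
  - apply: rpredZ; have := dhomogM hz (prod_lin_homog s').
    by rewrite subnK // s'_size; lia.
  - by rewrite mevalZ mevalM hc mul1r mulVf.
  - move=> j ij; rewrite mevalZ mevalM.
    suff js' : nth 0 s j \in s' by rewrite (prod_lin_at_mem js') !mulr0.
    rewrite /s' mem_cat; have [ji|ji|ji] := ltngtP j i.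
    + by rewrite -(nth_take _ ji) mem_nth // size_take ltn_ord.
    + have -> : nth 0 s j = nth 0 (drop i.+1 s) (j - i.+1) by rewrite nth_drop subnKC.
      by rewrite mem_nth ?orbT // size_drop ltn_sub2r ?(leq_ltn_trans ji).
    + by case/eqP: ij; apply: val_inj; rewrite /= ji.
have [L LE] := fin_all_exists ex.
by exists L; split=> [i|i|i j]; have [Lz L1 L0] := LE i; auto.
Qed.

Lemma form_at f c : f.@[coord c] =
  \sum_(m <- msupp f) f@_m * (c.1 ^+ m ord0 * c.2 ^+ m ord_max).
Proof.
rewrite mevalE; apply: eq_bigr => m _; congr (_ * _).
by rewrite big_ord_recl big_ord1; congr (_ * (_ ^+ m _)); apply: val_inj.
Qed.

Lemma mdeg2 (m : 'X_{1..2}) : mdeg m = (m ord0 + m ord_max)%N.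
Proof.
rewrite mdegE big_ord_recl big_ord1; congr (_ + m _)%N; exact: val_inj.
Qed.

(** As [q] does not vanish at the points of [s], each factor [lin c] of the
    product divides the cofactor [r] and can be cancelled. *)
Lemma homog_dvd_prod_lin_const q r s k d : all (fun c => c != 0) s ->
  q \is d.-homog -> (forall c, c \in s -> q.@[coord c] != 0) ->
  k *: prod_lin s = r * q -> exists r', k%:MP = r' * q.
Proof.
elim: s r => [|c s IH] r /=.
  by move=> _ _ _; rewrite /prod_lin big_nil -mul_mpolyC mulr1 => ->; exists r.
move=> /andP[c0 s0] qd q_at rE.
have [r' r'd r'E] := homog_quotient (rpredZ k (prod_lin_homog (c :: s))) qd rE.
have r'c : r'.@[coord c] = 0.
  have /eqP := congr1 (meval (coord c)) r'E.
  rewrite mevalZ prod_lin_at_mem ?mem_head // mulr0 eq_sym mevalM mulf_eq0.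
  by rewrite (negPf (q_at c (mem_head _ _))) orbF => /eqP.
have [p _ pE] := lin_dvdP c0 r'd r'c.
apply: (IH p s0 qd) => [c' c's|]; first by apply: q_at; rewrite in_cons c's orbT.
apply: (mulIf (lin_neq0 c0)); rewrite mulrAC -pE -r'E /prod_lin big_cons -scalerAl.
by rewrite mulrC.
Qed.

Hypothesis closedF : algebraically_closed F.

(** The dehomogenization [f(t,1)] has degree exactly [n.+1] unless [(1,0)] is
    a zero of [f]. *)
Lemma form_has_zero f n : f \is n.+1.-homog -> exists2 c, c != 0 & f.@[coord c] = 0.
Proof.
move=> fn; have [f10|f10] := eqVneq f.@[coord (1, 0)] 0.
  by exists (1, 0); rewrite // xpair_eqE oner_eq0.
pose r : {poly F} := \sum_(m <- msupp f) f@_m *: 'X^(m ord0).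
have rE t : r.[t] = f.@[coord (t, 1)].
  rewrite form_at horner_sum; apply: eq_bigr => m _.
  by rewrite hornerZ hornerXn expr1n mulr1.
have r_lead : r`_n.+1 = f.@[coord (1, 0)].
  rewrite form_at coef_sum !big_seq; apply: eq_bigr => m mf.
  rewrite coefZ coefXn expr1n mul1r expr0n; congr (_ * (_ : bool)%:R).
  by have := dhomog_mf fn mf; rewrite /= mdeg2; lia.
have [|t /eqP rt] := closedF (p := r).
  rewrite ltnNge; apply: contra f10 => r_size; rewrite -r_lead nth_default //.
  exact: leq_trans r_size _.
by exists (t, 1); rewrite -?rE // xpair_eqE oner_eq0 andbF.
Qed.

Lemma form_splits f n : f \is n.-homog -> f != 0 ->
  exists2 s, size s = n /\ all (fun c => c != 0) s
    & exists2 k, k != 0 & f = k *: prod_lin s.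
Proof.
elim: n f => [|n IH] f fn f0.
  exists [::] => //; exists f@_0; last first.
    rewrite /prod_lin big_nil -mul_mpolyC mulr1; apply: msize1_polyC.
    rewrite msizeE; apply/bigmax_leqP_seq => m mf _.
    by rewrite (dhomog_mf fn mf).
  apply: contraNneq f0 => f00; apply/eqP/mpolyP => m; rewrite mcoeff0.
  have [/eqP|m0] := eqVneq (mdeg m) 0%N; first by rewrite mdeg_eq0 => /eqP ->.
  exact: dhomog_nemf_coeff fn m0.
have [c c0 fc] := form_has_zero fn; have [q qn fE] := lin_dvdP c0 fn fc.
have q0 : q != 0 by apply: contraNneq f0 => q0; rewrite fE q0 mul0r.
have [s [s_size s0] [k k0 qE]] := IH q qn q0.
exists (c :: s); first by rewrite /= s_size c0.
by exists k => //; rewrite /prod_lin big_cons fE qE -scalerAl mulrC.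
Qed.

Lemma separable_neq0 f : separable f -> f != 0.
Proof.
apply: contraPneq => -> /(_ 1 0); rewrite xpair_eqE oner_eq0 => /(_ isT).
by apply; exists 0; rewrite mul0r.
Qed.

Lemma separable_dvd f g : separable g -> mpoly_dvd f g -> separable f.
Proof.
move=> sep_g [q gE] a b ab [q' fE]; apply: (sep_g a b ab).
by exists (q * q'); rewrite gE fE mulrA.
Qed.

(** Two proportional linear factors would give a square. *)
Lemma separable_prod_lin s k : all (fun c => c != 0) s -> k != 0 ->
  separable (k *: prod_lin s) -> all_apart s.
Proof.
move=> s0 k0 sep; apply/andP; split=> //.
have {k0}sep : separable (prod_lin s).
  move=> a b ab [q qE]; apply: (sep a b ab); exists (k *: q).
  by rewrite -scalerAl -qE.
elim: s s0 sep => //= c s IH /andP[c0 s0].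
rewrite /prod_lin big_cons => sep; apply/andP; split; last first.
  by apply: IH s0 _; apply: separable_dvd sep _; exists (lin c); rewrite mulrC.
apply/allP => c' c's; apply/negP => /eqP cc'.
have [u c'E] : exists u, c' = (u * c.1, u * c.2).
  case: c c' c0 cc' {s0 c's sep IH} => [a b] [a' b'] /= c0 cc'.
  have [a0|a0] := eqVneq a 0; last first.
    by exists (a' / a); rewrite divfK // mulrAC [a' * b]mulrC cc' [a * b']mulrC mulfK.
  move: c0 cc'; rewrite a0 mul0r xpair_eqE eqxx /= => b0 /eqP.
  rewrite mulf_eq0 (negPf b0) => /eqP ->.
  by exists (b' / b); rewrite mulr0 divfK.
apply: (sep c.2 (- c.1)).
  by case: (c) c0 => x y; rewrite !xpair_eqE oppr_eq0 andbC.
exists (u *: \prod_(d <- rem c' s) lin d).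
rewrite (perm_big _ (perm_to_rem c's)) big_cons /= scaleNr -/(lin c).
have -> : lin c' = u *: lin c by rewrite c'E /lin /= scalerBr !scalerA.
by rewrite -!scalerAl -!scalerAr expr2 mulrA [in RHS]mulrC.
Qed.

End BinaryForms.

(** * Orders and symbols *)

Section Orders.

Variable F : diffFieldType.
Implicit Types (u v w : dop F) (d a b : nat).

Lemma msize_map_mpoly (f : {additive F -> F}) (p : {mpoly F[2]}) d :
  (msize p <= d)%N -> (msize (map_mpoly f p) <= d)%N.
Proof.
by move=> /msize_leP pd; apply/msize_leP => m /pd; rewrite mcoeff_map_mpoly => ->; rewrite raddf0.
Qed.

(** The two summands of [d_x u = X_0 u + u'] behave differently: the first one
    raises degrees by one, the second one does not, so only the first
    contributes to the leading part. *)
Lemma shift_leading (f : {additive F -> F}) (i : 'I_2) (p : {mpoly F[2]}) d :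
  (msize p <= d.+1)%N ->
  (msize ('X_i * p + map_mpoly f p) <= d.+2)%N /\
  pihomog mdeg d.+1 ('X_i * p + map_mpoly f p) = 'X_i * pihomog mdeg d p.
Proof.
move=> pd; split.
  apply: leq_trans (msizeD_le _ _) _; rewrite geq_max; apply/andP; split.
    have [->|p0] := eqVneq p 0; first by rewrite mulr0 msize0.
    by rewrite msizeM // -?msize_poly_eq0 msizeX mdeg1 //= ltnS.
  exact: msize_map_mpoly (leqW pd).
rewrite raddfD /= mulrC -[d.+1]addn1 (pihomogM_homog _ _ (varX_homog F i)) mulrC.
rewrite addn1 [X in _ + X](_ : _ = 0) ?addr0 //.
apply/mpolyP => m; rewrite mcoeff_pihomog mcoeff0; case: eqP => // md.
by have /msize_leP := msize_map_mpoly f pd; apply; rewrite md.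
Qed.

Lemma dop_mon_leading (m : 'X_{1..2}) u d : (msize (nf u) <= d.+1)%N ->
  (msize (nf (dop_mon m u)) <= (mdeg m + d).+1)%N /\
  pihomog mdeg (mdeg m + d) (nf (dop_mon m u)) = 'X_[m] * pihomog mdeg d (nf u).
Proof.
move=> ud; have iterP (D : dop F -> dop F) i k v e :
    (forall v, exists f : {additive F -> F}, nf (D v) = 'X_i * nf v + map_mpoly f (nf v)) ->
    (msize (nf v) <= e.+1)%N ->
    (msize (nf (iter k D v)) <= (k + e).+1)%N /\
    pihomog mdeg (k + e) (nf (iter k D v)) = 'X_i ^+ k * pihomog mdeg e (nf v).
  move=> DE ve; elim: k => [|k [IH1 IH2]] /=; first by rewrite expr0 mul1r.
  have [f ->] := DE (iter k D v); have [S1 S2] := shift_leading f i IH1.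
  by split=> //; rewrite addSn S2 IH2 exprS mulrA.
have [Y1 Y2] := iterP (@dop_dy F) ord_max (m ord_max) u d
  (fun v => ex_intro _ (@dy F : {additive F -> F}) erefl) ud.
have [X1 X2] := iterP (@dop_dx F) ord0 (m ord0) _ _
  (fun v => ex_intro _ (@dx F : {additive F -> F}) erefl) Y1.
rewrite mdeg2 -addnA; split=> //; rewrite [LHS]X2 Y2.
rewrite mulrA; congr (_ * _); rewrite [RHS]mpolyXE_id big_ord_recl big_ord1.
by rewrite (_ : lift ord0 ord0 = ord_max :> 'I_2) //; apply: val_inj.
Qed.

(** Up to lower order terms operators commute: the leading part of a product is
    the commutative product of the leading parts. *)
Lemma mul_leading u v a b :
  (msize (nf u) <= a.+1)%N -> (msize (nf v) <= b.+1)%N ->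
  (msize (nf (u * v)%R) <= (a + b).+1)%N /\
  pihomog mdeg (a + b) (nf (u * v)) = pihomog mdeg a (nf u) * pihomog mdeg b (nf v).
Proof.
move=> ua vb; rewrite -[u * v]/(dop_mul u v) /dop_mul !raddf_sum /=; split.
  rewrite big_seq; apply: leq_trans (msize_sum _ _ _) _.
  apply/bigmax_leqP_seq => m _ mu; apply: leq_trans (msizeZ_le _ _) _.
  have [mv _] := dop_mon_leading m vb; apply: leq_trans mv _.
  by have := msize_mdeg_lt mu; lia.
rewrite [pihomog mdeg a _]pihomogE mulr_suml [RHS]big_mkcond /= !big_seq.
apply: eq_bigr => m mu; rewrite linearZ /=.
have [mv mvE] := dop_mon_leading m vb.
case: eqP => [<-|ma]; first by rewrite mvE scalerAl.
suff -> : pihomog mdeg (a + b) (nf (dop_mon m v)) = 0 by rewrite scaler0.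
apply/mpolyP => m'; rewrite mcoeff_pihomog mcoeff0; case: eqP => // m'ab.
move/msize_leP: mv; apply; rewrite m'ab.
by have := leq_trans (msize_mdeg_lt mu) ua; lia.
Qed.

Lemma nf_eq0 u : (nf u == 0) = (u == 0).
Proof. by rewrite -(inj_eq (@nf_inj F)). Qed.

Lemma ord_leE u d : (ord u <= d)%N = (msize (nf u) <= d.+1)%N.
Proof. by rewrite /ord; case: (msize _). Qed.

Lemma symb_homog u : symb u \is (ord u).-homog.
Proof. exact: pihomogP. Qed.

Lemma symb_eq0 u : (symb u == 0) = (u == 0).
Proof.
apply/eqP/eqP => [su|->]; last by rewrite /symb /= pihomog0.
apply/eqP; rewrite -nf_eq0; apply/negPn/negP => u0.
have := mlead_deg u0; move/(congr1 predn) => /= deg_lead.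
have := congr1 (mcoeff (mlead (nf u))) su.
by rewrite mcoeff_pihomog /ord deg_lead eqxx mcoeff0 => /eqP; rewrite mleadc_eq0 (negPf u0).
Qed.

Lemma leading_symb u d : (ord u <= d)%N -> pihomog mdeg d (nf u) != 0 ->
  ord u = d /\ symb u = pihomog mdeg d (nf u).
Proof.
move=> ud u0; suff -> : d = ord u by [].
apply/eqP; rewrite eqn_leq ud andbT leqNgt; apply: contra u0 => du.
apply/eqP/mpolyP => m; rewrite mcoeff_pihomog mcoeff0; case: eqP => // md.
have /msize_leP : (msize (nf u) <= d)%N by apply: leq_trans du; rewrite -ord_leE.
by apply; rewrite md.
Qed.

Lemma symb0 : symb (0 : dop F) = 0.
Proof. by apply/eqP; rewrite symb_eq0. Qed.

Lemma ord_symbM u v : u != 0 -> v != 0 ->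
  ord (u * v) = (ord u + ord v)%N /\ symb (u * v) = symb u * symb v.
Proof.
move=> u0 v0; have [||uv uvE] := @mul_leading u v (ord u) (ord v); rewrite -?ord_leE //.
have uvN0 : pihomog mdeg (ord u + ord v) (nf (u * v)) != 0.
  by rewrite uvE mulf_neq0 // ?[_ == 0]symb_eq0.
by have [|-> ->] := leading_symb _ uvN0; rewrite ?ord_leE.
Qed.

Lemma ordM u v : u != 0 -> v != 0 -> ord (u * v) = (ord u + ord v)%N.
Proof. by move=> u0 v0; have [] := ord_symbM u0 v0. Qed.

Lemma symbM u v : symb (u * v) = symb u * symb v.
Proof.
have [->|u0] := eqVneq u 0; first by rewrite mul0r symb0 mul0r.
have [->|v0] := eqVneq v 0; first by rewrite mulr0 symb0 mulr0.
by have [] := ord_symbM u0 v0.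
Qed.

Lemma dop_mul_eq0 u v : (u * v == 0) = (u == 0) || (v == 0).
Proof. by rewrite -!symb_eq0 symbM mulf_eq0. Qed.

Lemma Dop_homog (f : {mpoly F[2]}) d : f \is d.-homog -> f != 0 ->
  ord (Dop f) = d /\ symb (Dop f) = f.
Proof.
move=> fd f0; have fE : pihomog mdeg d (nf (Dop f)) = f by exact: pihomog_dE.
have [||-> ->] := @leading_symb (Dop f) d; rewrite ?fE //.
rewrite ord_leE; apply/msize_leP => m dm; apply: dhomog_nemf_coeff fd _.
by rewrite /= gtn_eqF.
Qed.

(** Orders compared with an integer, so that the zero operator, of order
    minus infinity, satisfies every bound. *)
Definition order_le (u : dop F) (m : int) : Prop := u != 0 -> ((ord u)%:Z <= m)%R.

Lemma order_le_trans u m m' : order_le u m -> (m <= m')%R -> order_le u m'.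
Proof. by move=> um mm' /um; lia. Qed.

Lemma order_le_ord u : order_le u (ord u).
Proof. by []. Qed.

Lemma order_leN u m : order_le u m -> order_le (- u) m.
Proof.
by move=> um; rewrite /order_le oppr_eq0 /ord /= msizeN => /um.
Qed.

Lemma order_le0 m : order_le 0 m.
Proof. by rewrite /order_le eqxx. Qed.

Lemma ord_max_le u v d : (ord u <= d)%N -> (ord v <= d)%N -> (ord (u + v)%R <= d)%N.
Proof.
rewrite !ord_leE => ud vd; apply: leq_trans (msizeD_le _ _) _.
by rewrite geq_max ud.
Qed.

Lemma ord_zero : ord (0 : dop F) = 0%N.
Proof. by rewrite /ord /= msize0. Qed.

Lemma ord_opp u : ord (- u) = ord u.
Proof. by rewrite /ord /= msizeN. Qed.

Lemma ord_lincomb_le d (J : finType) (r : J -> F) (f : J -> dop F) :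
  (forall j, ord (f j) <= d)%N -> (ord (\sum_j r j *: f j)%R <= d)%N.
Proof.
move=> fd; elim/big_ind: _ => [|x y|j _]; [by rewrite ord_zero|exact: ord_max_le|].
by rewrite ord_leE; apply: leq_trans (msizeZ_le _ _) _; rewrite -ord_leE.
Qed.

Lemma order_leD u v m : order_le u m -> order_le v m -> order_le (u + v) m.
Proof.
have [->|u0] := eqVneq u 0; first by rewrite add0r.
have [->|v0] := eqVneq v 0; first by rewrite addr0.
move=> /(_ u0) um /(_ v0) vm uv; case: m um vm => // d ud vd.
by apply: (@ord_max_le u v d); lia.
Qed.

Lemma order_leB u v m : order_le u m -> order_le v m -> order_le (u - v) m.
Proof. by move=> um vm; apply: order_leD => //; apply: order_leN. Qed.

Lemma order_leM u v m m' : order_le u m -> order_le v m' -> order_le (u * v) (m + m').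
Proof.
move=> um vm'; rewrite /order_le dop_mul_eq0 negb_or => /andP[u0 v0].
by rewrite ordM //; have := um u0; have := vm' v0; lia.
Qed.

Lemma order_le_cancel u v d : (ord u <= d)%N -> (ord v <= d)%N ->
  pihomog mdeg d (nf u) = pihomog mdeg d (nf v) -> order_le (u - v) (d%:Z - 1).
Proof.
move=> ud vd uvE; have uvd : (ord (u - v)%R <= d)%N.
  by apply: ord_max_le => //; rewrite /ord /= msizeN.
have uv0 : pihomog mdeg d (nf (u - v)) = 0 by rewrite !raddfB /= uvE subrr.
move=> u0; suff : (ord (u - v)%R != d)%N by lia.
apply: contraNneq u0 => uvd'; rewrite -symb_eq0 /symb uvd'; exact/eqP.
Qed.

Lemma symb_eq_cancel u v : u != 0 -> ord u = ord v -> symb u = symb v ->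
  order_le (u - v) ((ord u)%:Z - 1).
Proof.
by move=> u0 uv su; apply: order_le_cancel; rewrite ?uv // -{1}uv -/(symb u) su.
Qed.

Lemma symbD_small u v m : u != 0 -> order_le v m -> (m < (ord u)%:Z)%R ->
  ord (u + v) = ord u /\ symb (u + v) = symb u.
Proof.
move=> u0 vm mu; have [->|v0] := eqVneq v 0; first by rewrite addr0.
have vu : (ord v < ord u)%N by have := vm v0; lia.
have v_part : pihomog mdeg (ord u) (nf v) = 0.
  apply/mpolyP => m'; rewrite mcoeff_pihomog mcoeff0; case: eqP => // m'u.
  have /msize_leP : (msize (nf v) <= ord u)%N by apply: leq_trans vu; rewrite -ord_leE.
  by apply; rewrite m'u.
have uvE : pihomog mdeg (ord u) (nf (u + v)) = symb u by rewrite !raddfD /= v_part addr0.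
have [||-> ->] := @leading_symb (u + v) (ord u); rewrite ?uvE ?symb_eq0 //.
by apply: ord_max_le => //; apply: ltnW.
Qed.

End Orders.

Arguments order_le_ord {F} u _.

(** * The largest ideal with symbols vanishing at a point *)

Section LocalIdeal.

Variable F : diffFieldType.
Implicit Types (u v w s x : dop F) (I : dop F -> Prop) (c : F * F) (k : nat).

Definition regular_at c u : Prop := (symb u).@[coord c] != 0.

Lemma regular_at_neq0 c u : regular_at c u -> u != 0.
Proof. by apply: contraNneq => ->; rewrite symb0 meval0. Qed.

Lemma regular_atM c u v : regular_at c u -> regular_at c v -> regular_at c (u * v).
Proof. by rewrite /regular_at symbM mevalM => uc vc; rewrite mulf_neq0. Qed.

Lemma ord_one : ord (1 : dop F) = 0%N.
Proof. by rewrite /ord /= msize1. Qed.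

Lemma symb_one : symb (1 : dop F) = 1.
Proof.
by rewrite /symb ord_one pihomog_dE // dhomog1.
Qed.

Lemma regular_at1 c : regular_at c 1.
Proof. by rewrite /regular_at symb_one meval1 oner_eq0. Qed.

(** The Ore condition for the operators regular at [c], up to terms of
    arbitrarily small order: the leading part of the defect is removed by
    multiplying once more by an operator with the symbol of [s]. *)
Lemma approximate_ore c s x k : regular_at c s ->
  exists s' x', regular_at c s' /\
    order_le (s' * x - x' * s) ((ord s')%:Z + (ord x)%:Z - k%:Z).
Proof.
move=> sc; have s0 := regular_at_neq0 sc.
elim: k => [|k [s' [x' [s'c dk]]]].
  exists 1, 0; split; first exact: regular_at1.
  by rewrite mul1r mul0r subr0 ord_one => _; lia.
set d := s' * x - x' * s in dk.
have [d0|d0] := eqVneq d 0.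
  by exists s', x'; split=> //; rewrite -/d d0; apply: order_le0.
have s's0 : symb s != 0 by rewrite symb_eq0.
have sd0 : symb d != 0 by rewrite symb_eq0.
have [oe se] := Dop_homog (symb_homog s) s's0.
have [od sd] := Dop_homog (symb_homog d) sd0.
set e := Dop (symb s) in oe se; set y := Dop (symb d) in od sd.
have e0 : e != 0 by rewrite -symb_eq0 se.
have y0 : y != 0 by rewrite -symb_eq0 sd.
have s'0 := regular_at_neq0 s'c.
exists (e * s'), (e * x' + y); split.
  by apply: regular_atM s'c; rewrite /regular_at se.
have -> : e * s' * x - (e * x' + y) * s = e * d - y * s.
  by rewrite mulrBr mulrDl opprD !mulrA addrA.
apply: (order_le_trans (symb_eq_cancel _ _ _)).
- by rewrite dop_mul_eq0 negb_or e0.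
- by rewrite !ordM // oe od addnC.
- by rewrite !symbM se sd mulrC.
by have := dk d0; rewrite !ordM // oe; lia.
Qed.

(** The order of [x'] is bounded as if [s' * x = x' * s] held exactly; without
    this bound the errors multiplied by [x'] could not be controlled. *)
Lemma approximate_ore_ord s s' x x' k : s != 0 ->
  order_le (s' * x - x' * s) ((ord s')%:Z + (ord x)%:Z - k%:Z) ->
  order_le x' ((ord s')%:Z + (ord x)%:Z - (ord s)%:Z).
Proof.
move=> s0 sx x'0; have : order_le (x' * s) ((ord s')%:Z + (ord x)%:Z).
  have -> : x' * s = s' * x - (s' * x - x' * s) by rewrite opprB addrC subrK.
  apply: order_leB; first exact: order_leM (order_le_ord s') (order_le_ord x).
  by apply: order_le_trans sx _; lia.
by rewrite /order_le dop_mul_eq0 negb_or x'0 s0 ordM // => /(_ isT); lia.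
Qed.

(** Inverting the operators [s] regular at [c] localizes the symbol ring at the
    prime generated by [lin c].  In this localization, filtered by the order,
    the condition says that [u] lies in the closure of the left ideal generated
    by [P]. *)
Definition local_ideal c P u : Prop :=
  forall k, exists s a, regular_at c s /\
    order_le (s * u - a * P) ((ord s)%:Z - k%:Z).

Lemma local_ideal_principal c P : subideal (principal P) (local_ideal c P).
Proof.
move=> _ [a ->] k; exists 1, a; split; first exact: regular_at1.
by rewrite mul1r subrr; apply: order_le0.
Qed.

Lemma left_ideal_local c P : left_ideal (local_ideal c P).
Proof.
split=> [k|u v uL vL k|x u uL k].
- exists 1, 0; split; first exact: regular_at1.
  by rewrite mulr0 mul0r subrr; apply: order_le0.
- have [s [a [sc ua]]] := uL k; have [t [b [tc vb]]] := vL k.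
  have [s' [t' [s'c st]]] := approximate_ore t (k + ord u) sc.
  have t'o := approximate_ore_ord (regular_at_neq0 sc) st.
  exists (s' * t), (t' * a + s' * b); split; first exact: regular_atM.
  have -> : s' * t * (u + v) - (t' * a + s' * b) * P =
      (s' * t - t' * s) * u + t' * (s * u - a * P) + s' * (t * v - b * P).
    rewrite mulrDr mulrBl !mulrBr mulrDl !mulrA opprD [_ - _ + (_ - _)]addrA subrK.
    by rewrite addrACA.
  rewrite ordM ?(@regular_at_neq0 c) //; apply: order_leD; first apply: order_leD.
  + by apply: order_le_trans (order_leM st (order_le_ord u)) _; lia.
  + by apply: order_le_trans (order_leM t'o ua) _; lia.
  + by apply: order_le_trans (order_leM (order_le_ord s') vb) _; lia.
- have [s [a [sc ua]]] := uL (k + ord x)%N.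
  have [s' [x' [s'c sx]]] := approximate_ore x (k + ord u + ord x) sc.
  have x'o := approximate_ore_ord (regular_at_neq0 sc) sx.
  exists s', (x' * a); split=> //.
  have -> : s' * (x * u) - x' * a * P = (s' * x - x' * s) * u + x' * (s * u - a * P).
    by rewrite mulrBl mulrBr !mulrA addrA subrK.
  apply: order_leD.
    by apply: order_le_trans (order_leM sx (order_le_ord u)) _; lia.
  by apply: order_le_trans (order_leM x'o ua) _; lia.
Qed.

(** A regular element of the local ideal would make the symbol of some multiple
    of [P] regular at [c]. *)
Lemma local_ideal_irregular c P u : (symb P).@[coord c] = 0 ->
  local_ideal c P u -> (symb u).@[coord c] = 0.
Proof.
move=> Pc uL; apply/eqP/negPn/negP => uc.
have [s [a [sc ua]]] := uL 1%N.
have su0 : s * u != 0 by rewrite dop_mul_eq0 negb_or !(@regular_at_neq0 c).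
have [|_] := symbD_small su0 (order_leN ua).
  rewrite ordM ?(@regular_at_neq0 c) //; lia.
rewrite opprB addrC subrK => saP.
have := regular_atM sc uc; rewrite /regular_at -saP symbM mevalM Pc mulr0.
by rewrite eqxx.
Qed.

(** As [c] is a simple zero of the symbol of [P], a symbol vanishing at [c]
    becomes a multiple of the symbol of [P] after multiplication by a form that
    does not vanish at [c]; subtracting the corresponding multiple of [P] lowers
    the order and stays in [I], so it can be repeated. *)
Lemma local_ideal_largest c P I : c != 0 ->
  separable (symb P) -> (symb P).@[coord c] = 0 ->
  left_ideal I -> subideal (principal P) I ->
  (forall u, I u -> (symb u).@[coord c] = 0) ->
  subideal I (local_ideal c P).
Proof.
move=> c0 P_sep Pc [I0 ID IM] PI I_irr u uI.
have [p pd pE] := lin_dvdP c0 (symb_homog P) Pc.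
have P0 := separable_neq0 P_sep.
have p0 : p != 0 by apply: contraNneq P0 => p0; rewrite pE p0 mul0r.
have pc : p.@[coord c] != 0.
  apply/negP => /eqP /(lin_dvdP c0 pd)[q _ qE].
  case: c c0 Pc I_irr pE pd qE => a b c0 Pc I_irr pE pd qE.
  apply: (P_sep b (- a)); first by move: c0; rewrite !xpair_eqE oppr_eq0 andbC.
  by exists q; rewrite scaleNr -/(lin (a, b)) pE qE expr2 mulrA.
have PI' : I P by apply: PI; exists 1; rewrite mul1r.
suff approx k : exists s a, regular_at c s /\
    order_le (s * u - a * P) ((ord s)%:Z + (ord u)%:Z - k%:Z).
  move=> k; have [s [a [sc ua]]] := approx (k + ord u)%N; exists s, a; split=> //.
  by apply: order_le_trans ua _; lia.
elim: k => [|k [s [a [sc ua]]]].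
  exists 1, 0; split; first exact: regular_at1.
  by rewrite mul1r mul0r subr0 ord_one => _; lia.
set r := s * u - a * P in ua.
have [r0|r0] := eqVneq r 0.
  by exists s, a; split=> //; rewrite -/r r0; apply: order_le0.
have rI : I r by rewrite /r -mulNr; apply: ID; apply: IM.
have sr0 : symb r != 0 by rewrite symb_eq0.
have [q qd qE] := lin_dvdP c0 (symb_homog r) (I_irr _ rI).
have q0 : q != 0 by apply: contraNneq sr0 => q0; rewrite qE q0 mul0r.
have [oq sq] := Dop_homog qd q0; have [op sp] := Dop_homog pd p0.
set y := Dop q in oq sq; set t := Dop p in op sp.
have y0 : y != 0 by rewrite -symb_eq0 sq.
have t0 : t != 0 by rewrite -symb_eq0 sp.
have P0' : P != 0 by rewrite -symb_eq0.
exists (t * s), (t * a + y); split.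
  by apply: regular_atM sc; rewrite /regular_at sp.
have -> : t * s * u - (t * a + y) * P = t * r - y * P.
  by rewrite mulrBr mulrDl opprD !mulrA addrA.
have tr_yP : symb (t * r) = symb (y * P) by rewrite !symbM sp sq pE qE; ring.
have tr0 : t * r != 0 by rewrite dop_mul_eq0 negb_or t0.
have ord_eq : ord (t * r) = ord (y * P).
  apply: (dhomog_uniq _ (symb_homog (t * r))); first by rewrite symb_eq0.
  by rewrite tr_yP; apply: symb_homog.
apply: order_le_trans (symb_eq_cancel tr0 ord_eq tr_yP) _.
by have := ua r0; rewrite !ordM // ?(@regular_at_neq0 c) //; lia.
Qed.

End LocalIdeal.

(** * Hilbert functions *)

Section LeadingForms.

Variable F : diffFieldType.
Implicit Types (u v w : dop F) (c : F * F) (d e k z : nat).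

Variable I : dop F -> Prop.
Hypothesis idealI : left_ideal I.

Lemma ideal0 : I 0. Proof. by case: idealI. Qed.

Lemma idealD u v : I u -> I v -> I (u + v).
Proof. by case: idealI => _ ID _; apply: ID. Qed.

Lemma idealMl u v : I v -> I (u * v).
Proof. by case: idealI => _ _; apply. Qed.

Lemma idealZ (a : F) u : I u -> I (a *: u).
Proof. by move=> uI; rewrite -[u]mul1r scalerAl; apply: idealMl. Qed.

Lemma ideal_sum (J : finType) (f : J -> dop F) : (forall j, I (f j)) -> I (\sum_j f j).
Proof.
by move=> fI; elim/big_ind: _ => //; [exact: ideal0 | exact: idealD].
Qed.

(** The component of degree [z] is taken even if it is zero, so that these
    forms make up a subspace, which symbols of elements of [I] need not do. *)
Definition leading_form z (f : {mpoly F[2]}) : Prop :=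
  exists u, [/\ I u, (ord u <= z)%N & pihomog mdeg z (nf u) = f].

Lemma leading_formD z f g : leading_form z f -> leading_form z g -> leading_form z (f + g).
Proof.
move=> [u [uI uz uf]] [v [vI vz vg]]; exists (u + v); split.
- exact: idealD.
- exact: ord_max_le.
- by rewrite !raddfD /= uf vg.
Qed.

Lemma leading_formM z k f h : h \is k.-homog -> leading_form z f ->
  leading_form (k + z) (h * f).
Proof.
move=> hk [u [uI uz uf]]; exists (Dop h * u).
have h_size : (msize (nf (Dop h)) <= k.+1)%N.
  by apply/msize_leP => m km; apply: dhomog_nemf_coeff hk _; rewrite /= gtn_eqF.
have [|hu huE] := mul_leading h_size (b := z) (v := u); first by rewrite -ord_leE.
split; [exact: idealMl | by rewrite ord_leE|].
by rewrite huE uf (pihomog_dE hk).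
Qed.

Lemma leading_form_symb u : I u -> leading_form (ord u) (symb u).
Proof. by exists u. Qed.

Definition common_zero c : bool :=
  if excluded_middle_informative (forall u, I u -> (symb u).@[coord c] = 0)
  then true else false.

Lemma common_zeroP c : common_zero c -> forall u, I u -> (symb u).@[coord c] = 0.
Proof. by rewrite /common_zero; case: excluded_middle_informative. Qed.

Lemma common_zeroI c : (forall u, I u -> (symb u).@[coord c] = 0) -> common_zero c.
Proof. by rewrite /common_zero; case: excluded_middle_informative. Qed.

Lemma common_zeroPn c : ~~ common_zero c -> exists2 u, I u & (symb u).@[coord c] != 0.
Proof.
move=> nc; apply: NNPP => nu; move/negP: nc; apply; apply: common_zeroI => u uI.
by apply/eqP/negPn/negP => uc; apply: nu; exists u.
Qed.

Lemma leading_form_common_zero z f c :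
  leading_form z f -> common_zero c -> f.@[coord c] = 0.
Proof.
move=> [u [uI uz <-]] /common_zeroP cz.
have [->|u0] := eqVneq (pihomog mdeg z (nf u)) 0; first by rewrite meval0.
by have [_ <-] := leading_symb uz u0; apply: cz.
Qed.

(** Every form of large degree is congruent modulo [lin c] to a multiple of the
    symbol of [u], because this symbol does not vanish at [c]; hence multiples
    of [g] can be reduced to multiples of [lin c * g]. *)
Lemma drop_linear_factor c (g : {mpoly F[2]}) d N u : c != 0 -> I u ->
  (symb u).@[coord c] != 0 -> g \is d.-homog ->
  (forall z h, (N <= z)%N -> h \is z.-homog -> leading_form (z + d.+1) (h * (lin c * g))) ->
  forall z h, (N + (ord u).+1 <= z)%N -> h \is z.-homog -> leading_form (z + d) (h * g).
Proof.
move=> c0 uI uc gd lead z h zN hz.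
have [h1 h1z h1c] := homog_unit_at (z - ord u) c0.
pose a := h.@[coord c] / (symb u).@[coord c].
have h1u : h1 * symb u \is z.-homog.
  by have := dhomogM h1z (symb_homog u); rewrite subnK //; lia.
have hc : (h - a *: (h1 * symb u)).@[coord c] = 0.
  by rewrite mevalB mevalZ mevalM h1c mul1r /a divfK // subrr.
have [q qz qE] := lin_dvdP c0 (rpredB hz (rpredZ a h1u)) hc.
have -> : h * g = q * (lin c * g) + (a *: (h1 * g)) * symb u.
  rewrite mulrA -qE mulrBl -!scalerAl [h1 * g * _]mulrAC subrK //.
apply: leading_formD.
  have -> : (z + d = z.-1 + d.+1)%N by lia.
  by apply: lead => //; lia.
have -> : (z + d = (z - ord u + d) + ord u)%N by lia.
apply: leading_formM (leading_form_symb uI).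
by apply: rpredZ; apply: dhomogM.
Qed.

Variables (P : dop F) (cs : seq (F * F)) (k0 : F).
Hypotheses (PI : I P) (cs_apart : all_apart cs) (k0_neq0 : k0 != 0).
Hypothesis symbP : symb P = k0 *: prod_lin cs.

Definition common_zeros : seq (F * F) := filter common_zero cs.

Lemma common_zeros_apart : all_apart common_zeros.
Proof. exact: all_apart_filter. Qed.

Lemma prod_lin_cons c s : prod_lin (c :: s) = lin c * prod_lin s.
Proof. exact: big_cons. Qed.

(** The multiples of the symbol of [P] are leading forms.  Dropping one after
    the other the factors at the zeros of [P] that are not zeros of [I] leaves
    the multiples of the product over the common zeros, that is, the forms
    vanishing there. *)
Lemma leading_form_large : exists N, forall z f, (N <= z)%N -> f \is z.-homog ->
  (forall c, c \in common_zeros -> f.@[coord c] = 0) -> leading_form z f.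
Proof.
pose T s := exists N, forall z h, (N <= z)%N -> h \is z.-homog ->
  leading_form (z + size s) (h * prod_lin s).
have Tcs : T cs.
  exists 0%N => z h _ hz.
  have P0 : symb P != 0.
    rewrite symbP -mul_mpolyC mulf_neq0 ?mpolyC_eq0 // prodf_seq_neq0.
    case/andP: cs_apart => _ cs0; apply: sub_all cs0 => c; exact: lin_neq0.
  have -> : h * prod_lin cs = (k0^-1 *: h) * symb P.
    by rewrite symbP -scalerAl -scalerAr scalerA mulVf // scale1r.
  have <- : ord P = size cs.
    apply: (dhomog_uniq P0 (symb_homog P)).
    by rewrite symbP; apply: rpredZ; apply: prod_lin_homog.
  by apply: leading_formM (leading_form_symb PI); apply: rpredZ.
have cs_perm : perm_eq (filter (predC common_zero) cs ++ common_zeros) cs.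
  by rewrite perm_catC perm_filterC.
have {Tcs} : T (filter (predC common_zero) cs ++ common_zeros).
  have [N TN] := Tcs; exists N => z h zN hz.
  by rewrite (perm_size cs_perm) /prod_lin (perm_big _ cs_perm); apply: TN.
have Bs0 : all (fun c => c != 0) (filter (predC common_zero) cs).
  by apply/allP => c; rewrite mem_filter => /andP[_]; case/andP: cs_apart => _ /allP; apply.
have BsP : all (predC common_zero) (filter (predC common_zero) cs) by exact: filter_all.
elim: (filter (predC common_zero) cs) Bs0 BsP => /= [_ _ [N TN]|c s IH].
  exists (N + size common_zeros)%N => z f zN fz f0.
  have [q qz ->] := prod_lin_dvdP common_zeros_apart fz f0.
  have -> : z = (z - size common_zeros + size common_zeros)%N by lia.
  by apply: TN => //; lia.
move=> /andP[c0 s0] /andP[cB sB] [N TN]; apply: IH => //.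
have [u uI uc] := common_zeroPn cB.
exists (N + (ord u).+1)%N; apply: (drop_linear_factor c0 uI uc (prod_lin_homog _)).
by move=> z h zN hz; rewrite -prod_lin_cons; apply: TN.
Qed.

End LeadingForms.

Section QuotientDimension.

Variable F : diffFieldType.
Variable I : dop F -> Prop.
Hypothesis idealI : left_ideal I.
Implicit Types (u v w : dop F) (c : F * F) (d e k z : nat).

Definition indep_mod d (b : 'I_d -> dop F) : Prop :=
  forall a : 'I_d -> F, I (\sum_i a i *: b i) -> forall i, a i = 0.

(** If [e < d], a row vector in the kernel of the matrix of coefficients gives a
    relation between the [b i] modulo [I]. *)
Lemma indep_mod_le d e (b : 'I_d -> dop F) (b' : 'I_e -> dop F) :
  indep_mod b -> (forall i, exists a : 'I_e -> F, I (b i - \sum_j a j *: b' j)) ->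
  (d <= e)%N.
Proof.
move=> b_indep /fin_all_exists[C CE]; rewrite leqNgt; apply/negP => ed.
pose M : 'M[F]_(d, e) := \matrix_(i, j) C i j.
have : kermx M != 0.
  by rewrite kermx_eq0 /row_free neq_ltn (leq_ltn_trans (rank_leq_col M) ed).
move=> /rowV0Pn[x /sub_kermxP xM x0].
case/eqP: x0; apply/rowP => i; rewrite mxE; apply: (b_indep (x 0)).
have -> : \sum_i x 0 i *: b i = \sum_i x 0 i *: (b i - \sum_j C i j *: b' j).
  under [RHS]eq_bigr do rewrite scalerBr.
  rewrite sumrB [X in _ = _ - X](_ : _ = 0) ?subr0 //.
  under eq_bigr do rewrite scaler_sumr.
  rewrite exchange_big big1 // => j _.
  under eq_bigr do rewrite scalerA.
  rewrite -scaler_suml; have /rowP/(_ j) := xM; rewrite !mxE => xMj.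
  rewrite (eq_bigr (fun i => x 0 i * M i j)) ?xMj ?scale0r // => i' _.
  by rewrite mxE.
by apply: ideal_sum => // i'; apply: idealZ.
Qed.

Lemma image_dim_uniq z d e : image_dim I z d -> image_dim I z e -> d = e.
Proof.
move=> [b [bz bs bi]] [b' [b'z b's b'i]].
apply/eqP; rewrite eqn_leq; apply/andP; split.
  by apply: (indep_mod_le bi (b' := b')) => i; apply: b's.
by apply: (indep_mod_le b'i (b' := b)) => i; apply: bs.
Qed.

Definition cat_family d e (b : 'I_d -> dop F) (b' : 'I_e -> dop F)
    (i : 'I_(d + e)) : dop F :=
  match split i with inl j => b j | inr j => b' j end.

Lemma sum_cat_family d e (b : 'I_d -> dop F) (b' : 'I_e -> dop F) (a : 'I_(d + e) -> F) :
  \sum_i a i *: cat_family b b' i =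
  \sum_i a (lshift e i) *: b i + \sum_i a (rshift d i) *: b' i.
Proof.
rewrite big_split_ord /=; congr (_ + _); apply: eq_bigr => i _; rewrite /cat_family.
  by rewrite (unsplitK (inl i : 'I_d + 'I_e)).
by rewrite (unsplitK (inr i : 'I_d + 'I_e)).
Qed.

Lemma cat_family_ord d e (b : 'I_d -> dop F) (b' : 'I_e -> dop F) z :
  (forall i, (ord (b i) <= z)%N) -> (forall i, (ord (b' i) <= z)%N) ->
  forall i, (ord (cat_family b b' i) <= z)%N.
Proof. by move=> bz b'z i; rewrite /cat_family; case: split. Qed.

Lemma cat_family_indep d e (b : 'I_d -> dop F) (b' : 'I_e -> dop F) :
  indep_mod b ->
  (forall (a : 'I_d -> F) (a' : 'I_e -> F),
     I (\sum_i a i *: b i + \sum_i a' i *: b' i) -> forall i, a' i = 0) ->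
  indep_mod (cat_family b b').
Proof.
move=> bi b'i a; rewrite sum_cat_family => aI.
have a0 := b'i _ (fun i => a (rshift d i)) aI.
move: aI; rewrite [X in _ + X]big1 ?addr0 => [/bi al0|i _]; last by rewrite a0 scale0r.
by move=> i; rewrite -[i]splitK; case: split => j /=.
Qed.

(** Operators of order at most [z] form a space of finite dimension, so an
    independent family cannot be extended for ever. *)
Lemma image_dim_exists z : exists d, image_dim I z d.
Proof.
pose mons : 'I_#|{: 'X_{1..2 < z.+1}}| -> dop F := fun i => Dop 'X_[bmnm (enum_val i)].
have span u : (ord u <= z)%N -> exists a : 'I__ -> F, I (u - \sum_j a j *: mons j).
  move=> uz; exists (fun i => (nf u)@_(bmnm (enum_val i))).
  suff <- : u = \sum_j (nf u)@_(bmnm (enum_val j)) *: mons j.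
    by rewrite subrr; apply: ideal0.
  apply: nf_inj; rewrite raddf_sum /= [LHS](mpolywE (k := z.+1)) -?ord_leE //.
  by rewrite (reindex _ (onW_bij _ (enum_val_bij _))).
suff grow d : (exists d', image_dim I z d') \/
    exists b : 'I_d -> dop F, (forall i, (ord (b i) <= z)%N) /\ indep_mod b.
  have [//|[b [bz bi]]] := grow #|{: 'X_{1..2 < z.+1}}|.+1.
  have := indep_mod_le bi (b' := mons) (fun i => span _ (bz i)).
  by rewrite ltnn.
elim: d => [|d [|[b [bz bi]]]]; [|by left|].
  by right; exists (fun=> 0); split=> [i|a _ i]; case: i.
have [bs|] := classic (forall u, (ord u <= z)%N ->
    exists a : 'I_d -> F, I (u - \sum_i a i *: b i)); first by left; exists d, b.
move=> /not_all_ex_not[u nu]; have {nu}[uz nu] := imply_to_and _ _ nu; right; rewrite -addn1.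
exists (cat_family b (fun _ : 'I_1 => u)); split; first exact: cat_family_ord.
apply: cat_family_indep => // a a'; rewrite big_ord1 => aI i; rewrite ord1.
apply/eqP/negPn/negP => a'0; apply: nu; exists (fun i => - (a' 0)^-1 * a i).
have := idealZ idealI (a' 0)^-1 aI.
rewrite scalerDr scalerA mulVf // scale1r addrC scaler_sumr.
congr (I (_ + _)); rewrite -sumrN; apply: eq_bigr => j _.
by rewrite mulNr scaleNr opprK scalerA.
Qed.

End QuotientDimension.

Section HilbertFunction.

Variable F : diffFieldType.
Variable I : dop F -> Prop.
Hypothesis idealI : left_ideal I.
Variables (P : dop F) (cs : seq (F * F)) (k0 : F).
Hypotheses (PI : I P) (cs_apart : all_apart cs) (k0_neq0 : k0 != 0).
Hypothesis symbP : symb P = k0 *: prod_lin cs.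

(** The leading forms of large degree are cut out by vanishing at the common
    zeros, and these conditions are independent, so each order contributes one
    dimension for every common zero. *)
Lemma image_dim_step : exists N, forall z d, (N <= z)%N -> image_dim I z d ->
  image_dim I z.+1 (d + size (common_zeros I cs)).
Proof.
have [N leadN] := leading_form_large idealI PI cs_apart k0_neq0 symbP.
set s := common_zeros I cs in leadN *.
have s_zero (i : 'I_(size s)) : common_zero I (nth 0 s i).
  by have := mem_nth 0 (ltn_ord i); rewrite mem_filter => /andP[].
exists (N + size s)%N => z d zN [b [bz bs bi]].
have [|L [Lz L1 L0]] := @lagrange_forms _ s z.+1 (common_zeros_apart I cs_apart).
  by do 2!apply: leqW; apply: leq_trans zN; apply: leq_addl.
have Lat (a : 'I_(size s) -> F) (i : 'I_(size s)) :
    (\sum_j a j *: L j).@[coord (nth 0 s i)] = a i.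
  rewrite raddf_sum (bigD1 i) //= mevalZ L1 mulr1 big1 ?addr0 // => j ji.
  by rewrite mevalZ L0 ?mulr0.
have L_ord i : (ord (Dop (L i)) <= z.+1)%N.
  rewrite ord_leE; apply/msize_leP => m zm; apply: dhomog_nemf_coeff (Lz i) _.
  by rewrite /= gtn_eqF.
have L_lead (a : 'I_(size s) -> F) :
    pihomog mdeg z.+1 (nf (\sum_j a j *: Dop (L j))) = \sum_j a j *: L j.
  rewrite raddf_sum raddf_sum /=; apply: eq_bigr => j _.
  by rewrite linearZ /= (pihomog_dE (Lz j)).
exists (cat_family b (fun i => Dop (L i))); split.
- by apply: cat_family_ord => // i; apply: leq_trans (bz i) _.
- move=> u uz; pose f := pihomog mdeg z.+1 (nf u).
  pose a (i : 'I_(size s)) := f.@[coord (nth 0 s i)].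
  have [||c|w [wI wz wf]] := leadN z.+1 (f - \sum_j a j *: L j).
  + lia.
  + apply: rpredB; first exact: pihomogP.
    by apply: rpred_sum => j _; apply: rpredZ; apply: Lz.
  + move=> /(nthP 0)[i si <-]; rewrite mevalB (Lat a (Ordinal si)) subrr //.
  pose v := u - \sum_j a j *: Dop (L j) - w.
  have v_ord : (ord v <= z)%N.
    have aL : (ord (\sum_j a j *: Dop (L j))%R <= z.+1)%N.
      exact: ord_lincomb_le.
    have uaL : (ord (u - \sum_j a j *: Dop (L j))%R <= z.+1)%N.
      by apply: ord_max_le; rewrite ?ord_opp //; apply: leqW.
    have [->|v0] := eqVneq v 0; first by rewrite ord_zero.
    have := order_le_cancel uaL wz; rewrite wf !raddfB /= L_lead => /(_ erefl v0).
    by rewrite -/v; lia.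
  have [a' a'I] := bs v v_ord.
  exists (fun i => match split i with inl j => a' j | inr j => a j end).
  rewrite sum_cat_family.
  rewrite (eq_bigr (fun i => a' i *: b i)); last first.
    by move=> i _; rewrite (unsplitK (inl i : 'I_d + 'I_(size s))).
  rewrite [X in _ - (_ + X)](eq_bigr (fun j => a j *: Dop (L j))); last first.
    by move=> j _; rewrite (unsplitK (inr j : 'I_d + 'I_(size s))).
  have := idealD idealI a'I wI; congr (I _).
  by rewrite /v addrAC subrK opprD addrA [RHS]addrAC.
- apply: cat_family_indep => // a a' aI i.
  set w := _ + _ in aI.
  have w_lead : pihomog mdeg z.+1 (nf w) = \sum_j a' j *: L j.
    rewrite !raddfD /= L_lead [X in X + _](_ : _ = 0) ?add0r //.
    apply/mpolyP => m; rewrite mcoeff_pihomog mcoeff0; case: eqP => // mz.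
    have /msize_leP : (msize (nf (\sum_i a i *: b i)%R) <= z.+1)%N.
      by rewrite -ord_leE; apply: ord_lincomb_le.
    by apply; rewrite mz.
  have w_ord : (ord w <= z.+1)%N.
    apply: ord_max_le; apply: ord_lincomb_le => // j.
    by apply: leq_trans (bz j) _.
  rewrite -(Lat a' i); apply: (@leading_form_common_zero _ I z.+1) (s_zero i).
  by exists w.
Qed.

Lemma image_dim_linear : exists N d0, forall k,
  image_dim I (N + k) (d0 + k * size (common_zeros I cs)).
Proof.
have [N stepN] := image_dim_step; have [d0 Nd0] := image_dim_exists idealI N.
exists N, d0; elim=> [|k IH]; first by rewrite mul0n !addn0.
rewrite addnS mulSn [(size _ + _)%N]addnC addnA.
by apply: stepN IH; apply: leq_addr.
Qed.

(** The dimensions eventually grow by the number of common zeros from each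
    order to the next; if there is none they are eventually constant, which
    no polynomial of degree one is. *)
Lemma nonholonomicP : nonholonomic I <-> has (common_zero I) cs.
Proof.
have [N [d0 dimN]] := image_dim_linear.
rewrite has_count -size_filter -/(common_zeros I cs).
set e := size _ in dimN *; split=> [[p [[z0 pz] p_size]]|e0].
  rewrite lt0n; apply: contraPneq p_size => e0.
  have p_const z : (N + z0 <= z)%N -> p.[z%:R] = d0%:R.
    move=> zN; have [|d [zd ->]] := pz z; first by lia.
    congr _%:R; apply: (image_dim_uniq idealI zd).
    by have := dimN (z - N)%N; rewrite e0 muln0 addn0 subnKC //; lia.
  have := p_const (N + z0).+1 (leqnSn _); rewrite -(p_const _ (leqnn _)).
  move=> + p_size; rewrite !horner_coef p_size !big_ord_recl !big_ord0 /=.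
  rewrite !expr0 !mulr1 !addr0 => /addrI /eqP.
  rewrite !expr1 -natr1 mulrDr mulr1 -[X in _ == X]addr0 (inj_eq (addrI _)).
  by rewrite -[p`__]/(p`_(2.-1)) -p_size -/(lead_coef p) lead_coef_eq0 -size_poly_eq0 p_size.
exists (e%:R%:P * 'X + (d0%:R - N%:R * e%:R)%:P); split.
  exists N => z Nz; exists (d0 + (z - N) * e)%N; split.
    by have := dimN (z - N)%N; rewrite subnKC.
  rewrite hornerMXaddC hornerC natrD natrM natrB //; ring.
rewrite size_MXaddC polyC_eq0 pnatr_eq0 -[e == 0]negbK -lt0n e0 /=.
by rewrite size_polyC pnatr_eq0 -lt0n e0.
Qed.

End HilbertFunction.

(** * Maximal overideals *)

Section Divisibility.

Variable F : fieldType.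
Implicit Types f g h : {mpoly F[2]}.

Lemma mpoly_dvd_trans f g h : mpoly_dvd f g -> mpoly_dvd g h -> mpoly_dvd f h.
Proof. by move=> [q ->] [r ->]; exists (r * q); rewrite mulrA. Qed.

Lemma mpoly_dvd_mull f g h : mpoly_dvd f g -> mpoly_dvd f (h * g).
Proof. by move=> [q ->]; exists (h * q); rewrite mulrA. Qed.

Lemma mpoly_dvd_at f g c : mpoly_dvd f g -> f.@[coord c] = 0 -> g.@[coord c] = 0.
Proof. by move=> [q ->] fc; rewrite mevalM fc mulr0. Qed.

End Divisibility.

Section AttachedPolynomial.

Variable F : diffFieldType.
Implicit Types (u : dop F) (I : dop F -> Prop) (c : F * F) (f g : {mpoly F[2]}).

Lemma symb_idealI I u : I u -> symb_ideal I (symb u).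
Proof. by move=> uI; exists 1%N, (fun=> 1), (fun=> u); rewrite big_ord1 mul1r. Qed.

Lemma symb_ideal_dvd I g : (forall u, I u -> mpoly_dvd g (symb u)) ->
  forall f, symb_ideal I f -> mpoly_dvd g f.
Proof.
move=> gI f [k [q [u [uI ->]]]]; elim/big_ind: _ => [|x y [a ->] [b ->]|i _].
- by exists 0; rewrite mul0r.
- by exists (a + b); rewrite mulrDl.
- exact/mpoly_dvd_mull/gI.
Qed.

Lemma attached_dvd I g u : attached I g -> I u -> mpoly_dvd g (symb u).
Proof. by move=> [_ [gI _]] uI; apply/gI/symb_idealI. Qed.

Lemma prod_common_zeros_dvd I cs u : all_apart cs -> I u ->
  mpoly_dvd (prod_lin (common_zeros I cs)) (symb u).
Proof.
move=> cs_apart uI.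
have [c|q _ ->] := prod_lin_dvdP (common_zeros_apart I cs_apart) (symb_homog u).
  by rewrite mem_filter => /andP[/common_zeroP cI _]; apply: cI.
by exists q.
Qed.

(** The product over the common zeros divides all symbols, hence [g].  The
    cofactor divides the symbol of [P] and vanishes at none of the other zeros
    of [P], so it is constant. *)
Lemma attached_common_zeros I P cs k0 g : I P -> all_apart cs -> k0 != 0 ->
  symb P = k0 *: prod_lin cs -> attached I g ->
  mpoly_dvd (prod_lin (common_zeros I cs)) g /\
  mpoly_dvd g (prod_lin (common_zeros I cs)).
Proof.
move=> PI cs_apart k0_neq0 symbP gI; set A := common_zeros I cs.
have [[d gd] [_ g_max]] := gI.
have [q gE] : mpoly_dvd (prod_lin A) g.
  apply: g_max; apply: symb_ideal_dvd => u uI; exact: prod_common_zeros_dvd.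
split; first by exists q.
have [q' q'd {gE}gE] := homog_quotient gd (prod_lin_homog A) gE.
have [r rE] := attached_dvd gI PI.
have cs0 : all (fun c => c != 0) cs by case/andP: cs_apart.
pose B := filter (predC (common_zero I)) cs.
have A0 : prod_lin A != 0.
  rewrite prodf_seq_neq0; apply/allP => c; rewrite mem_filter => /andP[_ /(allP cs0)].
  exact: lin_neq0.
have B0 : all (fun c => c != 0) B.
  by apply/allP => c; rewrite mem_filter => /andP[_ /(allP cs0)].
have q'B c : c \in B -> q'.@[coord c] != 0.
  rewrite mem_filter => /andP[/common_zeroPn[u uI uc] _].
  apply: contraNneq uc => q'c; apply/eqP.
  apply: mpoly_dvd_at (attached_dvd gI uI) _.
  by rewrite gE mevalM q'c mul0r.
have AB : prod_lin cs = prod_lin B * prod_lin A.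
  by rewrite mulrC /prod_lin -big_cat; apply: perm_big; rewrite perm_sym perm_filterC.
have BE : k0 *: prod_lin B = r * q'.
  by apply: (mulIf A0); rewrite -scalerAl -AB -symbP rE gE mulrA.
have [r' r'E] := homog_dvd_prod_lin_const B0 q'd q'B BE.
exists (k0^-1 *: r'); rewrite gE mulrA -scalerAl -r'E -mul_mpolyC -mpolyCM.
by rewrite mulVf // mul1r.
Qed.

End AttachedPolynomial.

Theorem theorem1 (F : diffFieldType) (P : dop F) :
  [pchar F] =i pred0 ->
  differentially_closed F ->
  separable (symb P) ->
  at_most (ord P) (maximal_among (nonholonomic_over (principal P))) /\
  forall g : {mpoly F[2]},
    (exists I, nonholonomic_over (principal P) I /\ attached I g) ->
    exists M,
      maximal_among
        (fun I => nonholonomic_over (principal P) I /\ attached I g) M /\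
      forall M',
        maximal_among
          (fun I => nonholonomic_over (principal P) I /\ attached I g) M' ->
        same_ideal M' M.
Proof.
move=> char0 dcF P_sep.
have closedF := differentially_closed_algebraically_closed char0 dcF.
have P0 := separable_neq0 P_sep.
have [cs [cs_size cs0] [k0 k0_neq0 symbP]] := form_splits closedF (symb_homog P) P0.
have cs_apart : all_apart cs by apply: (separable_prod_lin cs0 k0_neq0); rewrite -symbP.
have Pcs c : c \in cs -> c != 0 /\ (symb P).@[coord c] = 0.
  move=> c_cs; split; first exact: (allP cs0).
  by rewrite symbP mevalZ prod_lin_at_mem // mulr0.
have PP : principal P P by exists 1; rewrite mul1r.
have nonholE I : left_ideal I -> I P -> nonholonomic I <-> has (common_zero I) cs.
  by move=> idealI PI; apply: nonholonomicP symbP.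
have localE I c : c \in cs -> left_ideal I -> subideal (principal P) I ->
    common_zero I c -> subideal I (local_ideal c P).
  move=> /Pcs[c0 Pc] idealI PI /common_zeroP Ic.
  exact: local_ideal_largest.
split.
  (* A maximal overideal is the local ideal at any of its common zeros. *)
  exists (fun i => local_ideal (nth 0 cs i) P) => I [[idealI PI nhI] I_max].
  have /hasP[c c_cs Ic] := (nonholE I idealI (PI _ PP)).1 nhI.
  have c_index : (index c cs < ord P)%N by rewrite -cs_size index_mem.
  exists (Ordinal c_index); rewrite /= nth_index // => u.
  have I_loc := localE I c c_cs idealI PI Ic.
  split; first exact: I_loc.
  apply: I_max I_loc u; split; first exact: left_ideal_local.
    exact: local_ideal_principal.
  apply/nonholE; [exact: left_ideal_local | exact: local_ideal_principal |].
  apply/hasP; exists c => //; apply: common_zeroI => u.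
  exact: local_ideal_irregular (Pcs c c_cs).2.
move=> g [I0 [[idealI0 PI0 nhI0] gI0]].
pose A := common_zeros I0 cs.
have [Ag gA] := attached_common_zeros (PI0 _ PP) cs_apart k0_neq0 symbP gI0.
(* The largest left ideal containing [P] with all zeros of [A]. *)
pose M u := forall c, c \in A -> local_ideal c P u.
have A_cs c : c \in A -> c \in cs by rewrite mem_filter => /andP[].
have idealM : left_ideal M.
  split=> [c _|u v uM vM c cA|a u uM c cA].
  - by case: (left_ideal_local c P).
  - by case: (left_ideal_local c P) => _ + _; apply; [exact: uM | exact: vM].
  - by case: (left_ideal_local c P) => _ _; apply; exact: uM.
have PM : subideal (principal P) M.
  by move=> u uP c _; apply: local_ideal_principal.
have M_zero c : c \in A -> common_zero M c.
  move=> cA; apply: common_zeroI => u /(_ c cA).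
  exact: local_ideal_irregular (Pcs c (A_cs c cA)).2.
have M_largest K : nonholonomic_over (principal P) K /\ attached K g -> subideal K M.
  move=> [[idealK PK _] gK] u uK c cA; apply: (localE K c (A_cs c cA)) uK => //.
  apply: common_zeroI => v /(attached_dvd gK) gv.
  by apply: mpoly_dvd_at (mpoly_dvd_trans Ag gv) _; apply: prod_lin_at_mem.
have MC : nonholonomic_over (principal P) M /\ attached M g.
  split.
    split=> //; apply/nonholE => //; first exact: PM.
    have /hasP[c c_cs cI0] := (nonholE I0 idealI0 (PI0 _ PP)).1 nhI0.
    by apply/hasP; exists c => //; apply: M_zero; rewrite mem_filter cI0.
  split; first by case: gI0.
  split=> [|h hM]; last first.
    have [_ [_ g_max]] := gI0; apply: g_max; apply: symb_ideal_dvd => u uI0.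
    apply/hM/symb_idealI; apply: M_largest uI0; split=> //; split=> //.
  apply: symb_ideal_dvd => u uM; apply: mpoly_dvd_trans gA _.
  have [c cA|q _ ->] := prod_lin_dvdP (common_zeros_apart I0 cs_apart) (symb_homog u).
    by have /common_zeroP := M_zero c cA; apply.
  by exists q.
exists M; split; first by split=> // K KC _; apply: M_largest.
move=> M' [M'C M'_max] u; split; first exact: M_largest M'C u.
by apply: M'_max MC _ u; apply: M_largest.
Qed.
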